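(* For all $s_1,s_2\in\mathbb{C}_+$, $$\rho_{\mathscr{H}^{\infty}}(s_1,s_2)=\sup_{p}\ \rho_{\mathbb{D}}(p^{-s_1},p^{-s_2}),$$ where the supremum is taken over all prime numbers $p$.
   Context: $\mathbb{C}_+=\{s\in\mathbb{C}:\operatorname{Re}(s)>0\}$. $\mathscr{H}^\infty$ is the uniform algebra, with the sup norm on $\mathbb{C}_+$, of all bounded analytic functions $f$ on $\mathbb{C}_+$ that can be represented by a Dirichlet series $f(s)=\sum_{n\ge1}a_n n^{-s}$ (convergent in some half-plane). The Gleason distance between points of $\mathbb{C}_+$ (identified with evaluation characters) is $\rho_{\mathscr{H}^\infty}(s,t)=\sup\{|f(s)|: f\in\mathscr{H}^\infty,\ \|f\|\le1,\ f(t)=0\}$. For $z,w$ in the open unit disc $\mathbb{D}$, $\rho_{\mathbb{D}}(z,w)=\left|\frac{z-w}{1-\overline{z}w}\right|$. *)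

(* Defs.v *)
From Stdlib Require Export Reals ZArith Znumtheory.
From Coquelicot Require Export Coquelicot.
Open Scope R_scope.

Definition half_plane (sigma : R) (s : C) : Prop := sigma < Re s.

Definition C_plus : C -> Prop := half_plane 0.

(* Euler's formula: exp (x + i y) = exp x * (cos y + i sin y). *)
Definition Cexp (z : C) : C :=
  (exp (Re z) * cos (Im z), exp (Re z) * sin (Im z)).

(* n^z with the real logarithm of n; only meaningful for n >= 1, since [ln 0]
   is a default value. *)
Definition nat_cpow (n : nat) (z : C) : C := Cexp (RtoC (ln (INR n)) * z)%C.

(* The derivative is the complex one: [ex_derive] is taken over [C_AbsRing]. *)
Definition analytic_on (D : C -> Prop) (f : C -> C) : Prop :=
  forall s : C, D s -> @ex_derive C_AbsRing C_NormedModule f s.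

Definition bounded_on (D : C -> Prop) (f : C -> C) : Prop :=
  exists M : R, forall s : C, D s -> Cmod (f s) <= M.

(* f(s) is the sum over n >= 1 of a_n n^{-s}, written with n = k + 1; the value
   [a 0] is not used. *)
Definition dirichlet_sum (a : nat -> C) (s l : C) : Prop :=
  @is_series C_AbsRing C_NormedModule
    (fun k : nat => (a (S k) * nat_cpow (S k) (- s))%C) l.

(* Asking that the half-plane of convergence lie in [C_plus] is no restriction,
   as it can always be shrunk, and f only matters on [C_plus]. *)
Definition dirichlet_representable (f : C -> C) : Prop :=
  exists (a : nat -> C) (sigma : R),
    0 <= sigma /\ forall s : C, half_plane sigma s -> dirichlet_sum a s (f s).

(* Elements are total functions on C, of which only the restriction to
   [C_plus] is constrained or used. *)
Definition H_infty (f : C -> C) : Prop :=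
  analytic_on C_plus f /\ bounded_on C_plus f /\ dirichlet_representable f.

Definition sup_norm (f : C -> C) : Rbar :=
  Lub_Rbar (fun x : R => exists s : C, C_plus s /\ x = Cmod (f s)).

(* Suprema are taken in the extended reals. *)
Definition gleason_dist (s t : C) : Rbar :=
  Lub_Rbar (fun x : R => exists f : C -> C,
    H_infty f /\ Rbar_le (sup_norm f) 1 /\ f t = RtoC 0 /\ x = Cmod (f s)).

Definition rho_disc (z w : C) : R :=
  Cmod ((z - w) / (RtoC 1 - Cconj z * w))%C.

Definition sup_primes (F : nat -> R) : Rbar :=
  Lub_Rbar (fun x : R => exists p : nat, prime (Z.of_nat p) /\ x = F p).

(* Main.v *)
Require Import Defs.
From Stdlib Require Import Lra Lia List ClassicalEpsilon.
From mathcomp Require ssreflect ssrbool eqtype ssrnat seq div bigop prime.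

(** Lower bound: for a prime p and x = p^{-s}, a = p^{-s2}, the function (x - a) / (1 - conj(a) x)
    belongs to the unit ball of H^infty (its Dirichlet series is a power series in p^{-s}),
    vanishes at s2, and has modulus rho_D(p^{-s1}, p^{-s2}) at s1.

    Upper bound, in three steps.
    Averaging f over a vertical segment against a kernel that concentrates at 0, and moving the
    segment by Goursat's theorem to the half-plane where the Dirichlet series of f converges
    absolutely, produces Dirichlet polynomials P with |P| <= 1 + eps on C_+ and P close to f at s1
    and s2.
    For such P = sum b_n n^{-s} and every completely multiplicative chi with values in the closed
    disc, |sum b_n chi(n)| <= sup |P| (Bohr): the coefficients of P^k are bounded in l^2 by
    (sup |P|)^k, the number of them grows only polynomially in k, and one takes k-th roots.
    If r bounds all rho_D(p^{-s1}, p^{-s2}), then p^{-s2} and p^{-s1} are the values at 0 and r of a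
    holomorphic self-map z_p of the disc; Schwarz's lemma for
    lambda |-> sum b_n prod_p z_p(lambda)^{v_p(n)} gives |f(s1)| <= r.  The maximum principle needed
    there is Bohr's inequality again, for Dirichlet polynomials in 2^{-s}. *)

(** * Complex differentiability *)

(** The Dirichlet series of f is only known to converge far to the right, and its partial sums need
    not be bounded by the sup of |f| on C_+, so suitable polynomials have to be manufactured.
    Averaging f(s + v) against a fixed kernel in v multiplies each term a_n n^{-s} by a constant. On
    a line far to the right, truncating the averaged series therefore gives a Dirichlet polynomial
    in s; on the line Re v = 0 the same average inherits the bound on f and is close to f(s). On the
    right-hand line the kernel is only bounded by 3^M, so the exponent M is fixed before the
    truncation length N.

    The polynomial P is only approximately 0 at s2, which is why Schwarz's lemma takes the form
    |F(x) - F(0)| <= |x| (M + |F(0)|). With F a uniform limit of polynomials on the closed disc, the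
    division by x takes place on a polynomial, where Bohr's inequality supplies the maximum
    principle. Bohr's inequality itself rests on the orthogonality in mean of the functions n^{-it}:
    distinct integers have distinct logarithms. *)

Definition Cder (f : C -> C) (z l : C) : Prop :=
  forall eps, 0 < eps -> exists del, 0 < del /\ forall h : C, Cmod h < del ->
    Cmod (f (z + h) - f z - l * h)%C <= eps * Cmod h.

(** The bridge between the epsilon-delta form, in which all estimates below are made, and the filter
    form used in [analytic_on]. *)
Lemma Cder_is_derive (f : C -> C) (z l : C) :
  Cder f z l <-> @is_derive C_AbsRing C_NormedModule f z l.
Proof.
  split.
  - intros H. split.
    + apply is_linear_scal_l.
    + intros x Hx eps.
      apply (@is_filter_lim_locally_unique _ (AbsRing_NormedModule C_AbsRing)) in Hx. subst x.
      destruct (H eps (cond_pos eps)) as [d [Hd Hd']].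
      exists (mkposreal d Hd).
      change (forall y : C, Cmod (y - z)%C < d ->
        Cmod (f y - f z - (y - z) * l)%C <= eps * Cmod (y - z)%C).
      intros y Hy.
      replace (f y - f z - (y - z) * l)%C
        with (f (z + (y - z)) - f z - l * (y - z))%C.
      * apply Hd', Hy.
      * replace (z + (y - z))%C with y by ring. ring.
  - intros [_ H] eps Heps.
    specialize (H z (fun P HP => HP) (mkposreal eps Heps)).
    destruct H as [d Hd].
    exists d. split; [apply cond_pos|]. intros h Hh.
    specialize (Hd (z + h)%C).
    change (Cmod ((z + h) - z)%C < d ->
      Cmod (f (z + h) - f z - ((z + h) - z) * l)%C <= eps * Cmod ((z + h) - z)%C) in Hd.
    replace (z + h - z)%C with h in Hd by ring.
    rewrite (Cmult_comm l h). apply Hd, Hh.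
Qed.

Lemma Cder_ext (f g : C -> C) (z l : C) :
  (forall w, f w = g w) -> Cder f z l -> Cder g z l.
Proof.
  intros E H eps He. destruct (H eps He) as [d [Hd H']].
  exists d; split; [exact Hd|]. intros h Hh. rewrite <- !E. now apply H'.
Qed.

Lemma Cder_const (c z : C) : Cder (fun _ => c) z 0%C.
Proof.
  intros eps He. exists 1. split; [lra|]. intros h _.
  replace (c - c - 0 * h)%C with (RtoC 0) by ring. rewrite Cmod_0.
  apply Rmult_le_pos; [lra|apply Cmod_ge_0].
Qed.

Lemma Cder_id (z : C) : Cder (fun w => w) z 1%C.
Proof.
  intros eps He. exists 1. split; [lra|]. intros h _.
  replace (z + h - z - 1 * h)%C with (RtoC 0) by ring. rewrite Cmod_0.
  apply Rmult_le_pos; [lra|apply Cmod_ge_0].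
Qed.

Lemma Cder_plus (f g : C -> C) (z l m : C) :
  Cder f z l -> Cder g z m -> Cder (fun w => f w + g w)%C z (l + m)%C.
Proof.
  intros Hf Hg eps He.
  destruct (Hf (eps / 2)) as [d1 [Hd1 H1]]; [lra|].
  destruct (Hg (eps / 2)) as [d2 [Hd2 H2]]; [lra|].
  exists (Rmin d1 d2). split; [now apply Rmin_glb_lt|]. intros h Hh.
  specialize (H1 h (Rlt_le_trans _ _ _ Hh (Rmin_l _ _))).
  specialize (H2 h (Rlt_le_trans _ _ _ Hh (Rmin_r _ _))).
  replace (f (z + h) + g (z + h) - (f z + g z) - (l + m) * h)%C
    with ((f (z + h) - f z - l * h) + (g (z + h) - g z - m * h))%C by ring.
  eapply Rle_trans; [apply Cmod_triangle|]. lra.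
Qed.

Definition Ccont (f : C -> C) (z : C) : Prop :=
  forall eps, 0 < eps -> exists del, 0 < del /\ forall h : C, Cmod h < del ->
    Cmod (f (z + h) - f z)%C < eps.

Lemma Cder_cont (f : C -> C) (z l : C) : Cder f z l -> Ccont f z.
Proof.
  intros H eps He. destruct (H 1 Rlt_0_1) as [d [Hd H']].
  assert (Hl := Cmod_ge_0 l).
  assert (Hq : 0 < eps / (2 + Cmod l)) by (apply Rdiv_lt_0_compat; lra).
  exists (Rmin d (eps / (2 + Cmod l))). split; [now apply Rmin_glb_lt|]. intros h Hh.
  specialize (H' h (Rlt_le_trans _ _ _ Hh (Rmin_l _ _))).
  assert (Hh2 := Rlt_le_trans _ _ _ Hh (Rmin_r _ _)).
  replace (f (z + h) - f z)%C with ((f (z + h) - f z - l * h) + l * h)%C by ring.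
  eapply Rle_lt_trans; [apply Cmod_triangle|]. rewrite Cmod_mult.
  assert (Hh0 := Cmod_ge_0 h).
  apply Rle_lt_trans with ((1 + Cmod l) * Cmod h); [lra|].
  apply Rle_lt_trans with ((2 + Cmod l) * Cmod h); [nra|].
  apply Rlt_le_trans with ((2 + Cmod l) * (eps / (2 + Cmod l))).
  - apply Rmult_lt_compat_l; lra.
  - apply Req_le. field. lra.
Qed.

Lemma Cder_mult (f g : C -> C) (z l m : C) :
  Cder f z l -> Cder g z m -> Cder (fun w => f w * g w)%C z (l * g z + f z * m)%C.
Proof.
  intros Hf Hg eps He.
  (* The four error terms of the expansion below add up to at most e K |h|. *)
  set (K := 1 + Cmod (f z) + Cmod l + Cmod (g z)).
  assert (HK : 1 <= K).
  { unfold K. assert (H1 := Cmod_ge_0 (f z)). assert (H2 := Cmod_ge_0 (g z)).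
    assert (H3 := Cmod_ge_0 l). lra. }
  set (e := eps / (3 * K)).
  assert (Hee : 0 < e) by (apply Rdiv_lt_0_compat; lra).
  assert (HeK : e * K = eps / 3) by (unfold e; field; lra).
  destruct (Hf e Hee) as [d1 [Hd1 H1]].
  destruct (Hg e Hee) as [d2 [Hd2 H2]].
  destruct (Cder_cont _ _ _ Hg (Rmin 1 e)) as [d3 [Hd3 H3]].
  { apply Rmin_glb_lt; lra. }
  exists (Rmin d1 (Rmin d2 d3)). split; [repeat apply Rmin_glb_lt; assumption|].
  intros h Hh.
  assert (Hh1 : Cmod h < d1) by (eapply Rlt_le_trans; [exact Hh|apply Rmin_l]).
  assert (Hh2 : Cmod h < d2).
  { eapply Rlt_le_trans; [exact Hh|]. eapply Rle_trans; [apply Rmin_r|apply Rmin_l]. }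
  assert (Hh3 : Cmod h < d3).
  { eapply Rlt_le_trans; [exact Hh|]. eapply Rle_trans; [apply Rmin_r|apply Rmin_r]. }
  specialize (H1 h Hh1). specialize (H2 h Hh2). specialize (H3 h Hh3).
  assert (H3a := Rlt_le_trans _ _ _ H3 (Rmin_l _ _)).
  assert (H3b := Rlt_le_trans _ _ _ H3 (Rmin_r _ _)).
  replace (f (z + h) * g (z + h) - f z * g z - (l * g z + f z * m) * h)%C
    with ((f (z + h) - f z - l * h) * g z
        + (f (z + h) - f z - l * h) * (g (z + h) - g z)
        + (l * h) * (g (z + h) - g z)
        + f z * (g (z + h) - g z - m * h))%C by ring.
  eapply Rle_trans; [apply Cmod_triangle|].
  eapply Rle_trans; [apply Rplus_le_compat_r, Cmod_triangle|].
  eapply Rle_trans; [apply Rplus_le_compat_r, Rplus_le_compat_r, Cmod_triangle|].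
  rewrite !Cmod_mult.
  set (A := Cmod (f (z + h) - f z - l * h)%C) in *.
  set (B := Cmod (g (z + h) - g z - m * h)%C) in *.
  set (D := Cmod (g (z + h) - g z)%C) in *.
  assert (HA : 0 <= A) by apply Cmod_ge_0.
  assert (HB : 0 <= B) by apply Cmod_ge_0.
  assert (HD : 0 <= D) by apply Cmod_ge_0.
  assert (Hx := Cmod_ge_0 h). assert (Hf0 := Cmod_ge_0 (f z)).
  assert (Hg0 := Cmod_ge_0 (g z)). assert (Hl0 := Cmod_ge_0 l).
  apply Rle_trans with (e * Cmod h * Cmod (g z) + e * Cmod h * 1
     + Cmod l * Cmod h * e + Cmod (f z) * (e * Cmod h)).
  - repeat apply Rplus_le_compat.
    + apply Rmult_le_compat_r; assumption.
    + apply Rmult_le_compat; lra.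
    + apply Rmult_le_compat_l; [apply Rmult_le_pos; assumption|lra].
    + apply Rmult_le_compat_l; assumption.
  - replace (e * Cmod h * Cmod (g z) + e * Cmod h * 1
     + Cmod l * Cmod h * e + Cmod (f z) * (e * Cmod h))
     with (e * K * Cmod h) by (unfold K; ring).
    rewrite HeK. apply Rmult_le_compat_r; lra.
Qed.

Lemma Cder_comp (f g : C -> C) (z l m : C) :
  Cder g z l -> Cder f (g z) m -> Cder (fun w => f (g w)) z (m * l)%C.
Proof.
  intros Hg Hf eps He.
  set (L := 1 + Cmod l). set (K := 1 + Cmod m).
  assert (Hl := Cmod_ge_0 l). assert (Hm := Cmod_ge_0 m).
  destruct (Hf (eps / (2 * L))) as [d1 [Hd1 H1]].
  { apply Rdiv_lt_0_compat; unfold L; lra. }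
  destruct (Cder_cont _ _ _ Hg d1 Hd1) as [d2 [Hd2 H2]].
  destruct (Hg (Rmin 1 (eps / (2 * K)))) as [d3 [Hd3 H3]].
  { apply Rmin_glb_lt; [lra|]. apply Rdiv_lt_0_compat; unfold K; lra. }
  exists (Rmin d2 d3). split; [now apply Rmin_glb_lt|].
  intros h Hh.
  specialize (H2 h (Rlt_le_trans _ _ _ Hh (Rmin_l _ _))).
  specialize (H3 h (Rlt_le_trans _ _ _ Hh (Rmin_r _ _))).
  assert (Hh0 := Cmod_ge_0 h).
  set (k := (g (z + h) - g z)%C) in *.
  specialize (H1 k H2).
  replace (g z + k)%C with (g (z + h))%C in H1 by (unfold k; ring).
  replace (f (g (z + h)) - f (g z) - m * l * h)%C
    with ((f (g (z + h)) - f (g z) - m * k) + m * (k - l * h))%C by ring.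
  eapply Rle_trans; [apply Cmod_triangle|]. rewrite Cmod_mult.
  assert (Hk : Cmod k <= L * Cmod h).
  { replace k with ((k - l * h) + l * h)%C by ring.
    eapply Rle_trans; [apply Cmod_triangle|]. rewrite Cmod_mult.
    assert (Cmod (k - l * h) <= 1 * Cmod h).
    { eapply Rle_trans; [exact H3|]. apply Rmult_le_compat_r; [lra|apply Rmin_l]. }
    unfold L. lra. }
  assert (Hb : Cmod (k - l * h) <= eps / (2 * K) * Cmod h).
  { eapply Rle_trans; [exact H3|]. apply Rmult_le_compat_r; [lra|apply Rmin_r]. }
  assert (HL : eps / (2 * L) * Cmod k <= eps / 2 * Cmod h).
  { apply Rle_trans with (eps / (2 * L) * (L * Cmod h)).
    - apply Rmult_le_compat_l; [|exact Hk]. apply Rlt_le, Rdiv_lt_0_compat; unfold L; lra.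
    - apply Req_le. field. unfold L; lra. }
  assert (HKK : Cmod m * Cmod (k - l * h) <= eps / 2 * Cmod h).
  { apply Rle_trans with (K * (eps / (2 * K) * Cmod h)).
    - apply Rmult_le_compat; [lra|apply Cmod_ge_0|unfold K; lra|exact Hb].
    - apply Req_le. field. unfold K; lra. }
  lra.
Qed.

Lemma Cder_inv (z : C) : z <> 0%C -> Cder (fun w => / w)%C z (- / (z * z))%C.
Proof.
  intros Hz eps He.
  assert (Hm : 0 < Cmod z) by now apply Cmod_gt_0.
  set (r := Cmod z) in *.
  assert (Hq : 0 < eps * (r * r * r) / 2).
  { apply Rdiv_lt_0_compat; [|lra]. repeat apply Rmult_lt_0_compat; lra. }
  (* The first radius keeps |z + h| >= r/2; the second then makes the remainder h^2/(z^2 (z + h)) at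
     most eps |h|. *)
  exists (Rmin (r / 2) (eps * (r * r * r) / 2)). split.
  { apply Rmin_glb_lt; lra. }
  intros h Hh.
  assert (Hh1 := Rlt_le_trans _ _ _ Hh (Rmin_l _ _)).
  assert (Hh2 := Rlt_le_trans _ _ _ Hh (Rmin_r _ _)).
  assert (Hzh : r / 2 <= Cmod (z + h)).
  { assert (T := Cmod_triangle (z + h) (- h)).
    replace (z + h + - h)%C with z in T by ring. rewrite Cmod_opp in T. fold r in T. lra. }
  assert (Hne : (z + h)%C <> 0%C) by (apply Cmod_gt_0; lra).
  replace (/ (z + h) - / z - - / (z * z) * h)%C with (h * h / (z * z * (z + h)))%C
    by (field; split; assumption).
  rewrite Cmod_div by (repeat apply Cmult_neq_0; assumption).
  rewrite !Cmod_mult. fold r.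
  assert (Hh0 := Cmod_ge_0 h).
  apply Rle_trans with (Cmod h * Cmod h / (r * r * (r / 2))).
  - apply Rmult_le_compat_l; [apply Rmult_le_pos; lra|].
    apply Rinv_le_contravar.
    + repeat apply Rmult_lt_0_compat; lra.
    + apply Rmult_le_compat_l; [apply Rmult_le_pos; lra|lra].
  - replace (Cmod h * Cmod h / (r * r * (r / 2)))
      with ((2 / (r * r * r)) * Cmod h * Cmod h) by (field; lra).
    apply Rmult_le_compat_r; [lra|].
    apply Rle_trans with (2 / (r * r * r) * (eps * (r * r * r) / 2)).
    + apply Rmult_le_compat_l; [|lra]. apply Rlt_le, Rdiv_lt_0_compat; [lra|].
      repeat apply Rmult_lt_0_compat; lra.
    + apply Req_le. field. lra.
Qed.

(** * The functional equation of the exponential and elementary Taylor estimates *)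

Lemma Cexp_plus (z w : C) : Cexp (z + w) = (Cexp z * Cexp w)%C.
Proof.
  unfold Cexp. destruct z as [a b], w as [c d]; simpl.
  rewrite exp_plus, cos_plus, sin_plus. unfold Cmult; simpl. f_equal; ring.
Qed.

Lemma Cexp_0 : Cexp 0 = 1%C.
Proof.
  unfold Cexp, RtoC; simpl. rewrite exp_0, cos_0, sin_0. f_equal; ring.
Qed.

Lemma Cmod_Cexp (z : C) : Cmod (Cexp z) = exp (Re z).
Proof.
  unfold Cexp, Cmod; simpl.
  replace (exp (Re z) * cos (Im z) * (exp (Re z) * cos (Im z) * 1) +
     exp (Re z) * sin (Im z) * (exp (Re z) * sin (Im z) * 1))
   with ((exp (Re z))² * ((sin (Im z))² + (cos (Im z))²)) by (unfold Rsqr; ring).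
  rewrite sin2_cos2, Rmult_1_r. apply sqrt_Rsqr, Rlt_le, exp_pos.
Qed.

(** The inequality 1 + x <= exp x, used at x and at -x, encloses exp x between 1 + x and 1/(1 -
    x). *)
Lemma exp_quadratic_bound (x : R) : Rabs x <= 1 / 2 -> Rabs (exp x - 1 - x) <= 2 * x ^ 2.
Proof.
  intros H. apply Rabs_le_between in H.
  assert (H1 := exp_ineq1_le x). assert (H2 := exp_ineq1_le (- x)).
  rewrite exp_Ropp in H2. assert (H3 := exp_pos x).
  assert (exp x * (1 - x) <= 1).
  { apply Rmult_le_compat_l with (r := exp x) in H2; [|lra].
    rewrite Rinv_r in H2 by lra. lra. }
  rewrite Rabs_pos_eq by lra. nra.
Qed.

Lemma sin_abs_le (y : R) : 0 <= y -> - y <= sin y <= y.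
Proof.
  intros [H|<-]; [|rewrite sin_0; lra].
  split; [|now apply Rlt_le, sin_lt_x].
  destruct (Rle_dec y PI) as [L|L].
  - assert (0 <= sin y) by (apply sin_ge_0; lra). lra.
  - assert (S := SIN_bound y). assert (P := PI_RGT_0). assert (P2 := PI2_1). lra.
Qed.

Lemma cos_quadratic_bound (y : R) : Rabs (cos y - 1) <= y ^ 2.
Proof.
  assert (E : cos y = 1 - 2 * (sin (y / 2)) ^ 2).
  { replace y with (2 * (y / 2)) at 1 by field. rewrite cos_2a_sin. ring. }
  rewrite E.
  assert (Hs : (sin (y / 2)) ^ 2 <= (y / 2) ^ 2).
  { destruct (Rle_dec 0 y) as [L|L].
    - assert (T := sin_abs_le (y / 2) ltac:(lra)). nra.
    - assert (T := sin_abs_le (- (y / 2)) ltac:(lra)). rewrite sin_neg in T. nra. }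
  rewrite Rabs_left1; nra.
Qed.

Lemma sin_quadratic_bound (y : R) : Rabs y <= 1 / 2 -> Rabs (sin y - y) <= y ^ 2.
Proof.
  intros H. apply Rabs_le_between in H.
  destruct (Rle_dec 0 y) as [L|L].
  - assert (S := sin_abs_le y L). rewrite Rabs_left1 by lra.
    (* At order 0 the alternating Taylor bound reads y - y^3/6 <= sin y. *)
    destruct (pre_sin_bound y 0 L ltac:(lra)) as [B _].
    unfold sin_approx, sin_term in B. simpl in B. nra.
  - assert (S := sin_abs_le (-y) ltac:(lra)). rewrite sin_neg in S. rewrite Rabs_pos_eq by lra.
    destruct (pre_sin_bound (-y) 0 ltac:(lra) ltac:(lra)) as [B _].
    rewrite sin_neg in B.
    unfold sin_approx, sin_term in B. simpl in B. nra.
Qed.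

(** * The complex exponential and n^s *)

Lemma Cmod_le_Re_Im (z : C) : Cmod z <= Rabs (Re z) + Rabs (Im z).
Proof.
  assert (H1 := Rabs_pos (Re z)). assert (H2 := Rabs_pos (Im z)).
  apply Rsqr_incr_0_var; [|lra].
  replace (Cmod z)² with (Cmod z ^ 2) by (unfold Rsqr; ring).
  rewrite Cmod2_alt, <- (pow2_abs (Re z)), <- (pow2_abs (Im z)). unfold Rsqr. nra.
Qed.

Lemma im_le_Cmod (z : C) : Rabs (Im z) <= Cmod z.
Proof. eapply Rle_trans; [apply Rmax_r|apply Rmax_Cmod]. Qed.

(** The real and the imaginary part of the remainder are each at most 4 |h|^2. Together with the
    functional equation this gives the derivative of the exponential everywhere. *)
Lemma Cexp_quadratic_bound (h : C) :
  Cmod h <= 1 / 2 -> Cmod (Cexp h - 1 - h)%C <= 8 * Cmod h ^ 2.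
Proof.
  intros Hh. assert (Hx := re_le_Cmod h). assert (Hy := im_le_Cmod h).
  destruct h as [x y]. set (r := Cmod (x, y)) in *. simpl Re in Hx. simpl Im in Hy.
  assert (Bx := exp_quadratic_bound x ltac:(lra)).
  assert (Bc := cos_quadratic_bound y).
  assert (Bs := sin_quadratic_bound y ltac:(lra)).
  rewrite <- (pow2_abs x) in Bx. rewrite <- (pow2_abs y) in Bc, Bs.
  assert (Px := Rabs_pos x). assert (Py := Rabs_pos y).
  assert (Ex : exp x <= 2).
  { assert (T := Rle_abs (exp x - 1 - x)). assert (T' := Rle_abs x). nra. }
  assert (Ep := exp_pos x).
  eapply Rle_trans; [apply Cmod_le_Re_Im|].
  unfold Cexp; simpl Re; simpl Im.
  replace (exp x * cos y + - (1) + - x) with ((exp x - 1 - x) + exp x * (cos y - 1)) by ring.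
  replace (exp x * sin y + - 0 + - y)
    with (exp x * (sin y - y) + ((exp x - 1 - x) * y + x * y)) by ring.
  assert (T1 : Rabs ((exp x - 1 - x) + exp x * (cos y - 1)) <= 2 * Rabs x ^ 2 + 2 * Rabs y ^ 2).
  { eapply Rle_trans; [apply Rabs_triang|]. rewrite Rabs_mult, (Rabs_pos_eq (exp x)) by lra.
    apply Rplus_le_compat; [exact Bx|]. apply Rmult_le_compat; try lra. apply Rabs_pos. }
  assert (T2 : Rabs (exp x * (sin y - y) + ((exp x - 1 - x) * y + x * y))
      <= 2 * Rabs y ^ 2 + (2 * Rabs x ^ 2 * Rabs y + Rabs x * Rabs y)).
  { eapply Rle_trans; [apply Rabs_triang|]. rewrite Rabs_mult, (Rabs_pos_eq (exp x)) by lra.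
    apply Rplus_le_compat.
    - apply Rmult_le_compat; try lra. apply Rabs_pos.
    - eapply Rle_trans; [apply Rabs_triang|]. rewrite !Rabs_mult.
      apply Rplus_le_compat_r. apply Rmult_le_compat_r; assumption. }
  assert (Rabs x ^ 2 <= r ^ 2) by (apply pow_incr; lra).
  assert (Rabs y ^ 2 <= r ^ 2) by (apply pow_incr; lra).
  assert (Rabs x * Rabs y <= r ^ 2) by nra.
  assert (2 * Rabs x ^ 2 * Rabs y <= r ^ 2) by nra.
  lra.
Qed.

Lemma Cder_Cexp (z : C) : Cder Cexp z (Cexp z).
Proof.
  intros eps He. assert (Hp : 0 < Cmod (Cexp z)) by (rewrite Cmod_Cexp; apply exp_pos).
  set (K := Cmod (Cexp z)) in *.
  exists (Rmin (1 / 2) (eps / (8 * K))). split.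
  { apply Rmin_glb_lt; [lra|]. apply Rdiv_lt_0_compat; lra. }
  intros h Hh.
  assert (Hh1 := Rlt_le_trans _ _ _ Hh (Rmin_l _ _)).
  assert (Hh2 := Rlt_le_trans _ _ _ Hh (Rmin_r _ _)).
  assert (Hh0 := Cmod_ge_0 h).
  rewrite Cexp_plus.
  replace (Cexp z * Cexp h - Cexp z - Cexp z * h)%C with (Cexp z * (Cexp h - 1 - h))%C by ring.
  rewrite Cmod_mult. fold K.
  apply Rle_trans with (K * (8 * Cmod h ^ 2)).
  { apply Rmult_le_compat_l; [lra|]. apply Cexp_quadratic_bound. lra. }
  replace (K * (8 * Cmod h ^ 2)) with (8 * K * Cmod h * Cmod h) by ring.
  apply Rmult_le_compat_r; [lra|].
  apply Rle_trans with (8 * K * (eps / (8 * K))).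
  - apply Rmult_le_compat_l; lra.
  - apply Req_le. field. lra.
Qed.

Lemma Cder_lin (a b z : C) : Cder (fun w => a * w + b)%C z a.
Proof.
  intros eps He. exists 1. split; [lra|]. intros h _.
  replace (a * (z + h) + b - (a * z + b) - a * h)%C with (RtoC 0) by ring. rewrite Cmod_0.
  apply Rmult_le_pos; [lra|apply Cmod_ge_0].
Qed.

Lemma Cder_nat_cpow_opp (n : nat) (z : C) :
  exists l, Cder (fun s => nat_cpow n (- s)%C) z l.
Proof.
  eexists. unfold nat_cpow.
  apply (Cder_comp Cexp (fun s => RtoC (ln (INR n)) * - s)%C).
  - apply (Cder_ext (fun s => (- RtoC (ln (INR n))) * s + 0)%C).
    + intros w. ring.
    + apply Cder_lin.
  - apply Cder_Cexp.
Qed.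

Lemma nat_cpow_plus (n : nat) (z w : C) : nat_cpow n (z + w) = (nat_cpow n z * nat_cpow n w)%C.
Proof. unfold nat_cpow. rewrite <- Cexp_plus. f_equal. ring. Qed.

Lemma nat_cpow_mult (m n : nat) (z : C) : (1 <= m)%nat -> (1 <= n)%nat ->
  nat_cpow (m * n) z = (nat_cpow m z * nat_cpow n z)%C.
Proof.
  intros Hm Hn. unfold nat_cpow. rewrite <- Cexp_plus, mult_INR, ln_mult.
  - f_equal. rewrite RtoC_plus. now rewrite Cmult_plus_distr_r.
  - now apply lt_0_INR.
  - now apply lt_0_INR.
Qed.

Lemma nat_cpow_1 (z : C) : nat_cpow 1 z = 1%C.
Proof. unfold nat_cpow. simpl INR. rewrite ln_1, Cmult_0_l. apply Cexp_0. Qed.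

Lemma nat_cpow_pow (m k : nat) (z : C) : (1 <= m)%nat -> nat_cpow (m ^ k) z = (nat_cpow m z ^ k)%C.
Proof.
  intros Hm. induction k as [|k IH].
  - apply nat_cpow_1.
  - rewrite Nat.pow_succ_r', nat_cpow_mult, IH, Cpow_S; [reflexivity|assumption|].
    apply Nat.neq_0_lt_0, Nat.pow_nonzero. lia.
Qed.

Lemma Cmod_nat_cpow (n : nat) (z : C) : Cmod (nat_cpow n z) = exp (ln (INR n) * Re z).
Proof. unfold nat_cpow. rewrite Cmod_Cexp. destruct z; simpl. f_equal. ring. Qed.

Lemma ln_INR_ge_0 (n : nat) : (1 <= n)%nat -> 0 <= ln (INR n).
Proof.
  intros H. rewrite <- ln_1. apply le_INR in H. simpl in H. apply ln_le; lra.
Qed.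

Lemma Cmod_nat_cpow_lt_1 (n : nat) (s : C) : (2 <= n)%nat -> 0 < Re s ->
  Cmod (nat_cpow n (- s)%C) < 1.
Proof.
  intros Hn Hs. rewrite Cmod_nat_cpow. rewrite <- exp_0.
  apply exp_increasing. assert (L : 0 < ln (INR n)).
  { rewrite <- ln_1. apply le_INR in Hn. simpl in Hn. apply ln_increasing; lra. }
  destruct s; simpl in *. nra.
Qed.

(** * Complex integrals along segments *)

Definition curve_cont (phi : R -> C) (t : R) : Prop :=
  forall eps, 0 < eps -> exists del, 0 < del /\ forall u, Rabs (u - t) < del ->
    Cmod (phi u - phi t)%C < eps.

Definition CInt (phi : R -> C) (a b : R) : C :=
  (RInt (fun t => Re (phi t)) a b, RInt (fun t => Im (phi t)) a b).

Lemma curve_cont_Re (phi : R -> C) (t : R) :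
  curve_cont phi t -> continuous (fun u => Re (phi u)) t.
Proof.
  intros H. apply continuity_pt_filterlim. intros eps He.
  destruct (H eps He) as [d [Hd H']]. exists d. split; [exact Hd|].
  intros x [_ Hx]. unfold dist in *; simpl in *; unfold R_dist in *.
  eapply Rle_lt_trans; [|apply (H' x Hx)].
  replace (Re (phi x) - Re (phi t)) with (Re (phi x - phi t)%C) by reflexivity.
  apply re_le_Cmod.
Qed.

Lemma curve_cont_Im (phi : R -> C) (t : R) :
  curve_cont phi t -> continuous (fun u => Im (phi u)) t.
Proof.
  intros H. apply continuity_pt_filterlim. intros eps He.
  destruct (H eps He) as [d [Hd H']]. exists d. split; [exact Hd|].
  intros x [_ Hx]. unfold dist in *; simpl in *; unfold R_dist in *.
  eapply Rle_lt_trans; [|apply (H' x Hx)].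
  replace (Im (phi x) - Im (phi t)) with (Im (phi x - phi t)%C) by reflexivity.
  apply im_le_Cmod.
Qed.

Lemma curve_cont_const (c : C) (t : R) : curve_cont (fun _ => c) t.
Proof.
  intros eps He. exists 1. split; [lra|]. intros u _.
  replace (c - c)%C with (RtoC 0) by ring. now rewrite Cmod_0.
Qed.

Lemma curve_cont_plus (f g : R -> C) (t : R) :
  curve_cont f t -> curve_cont g t -> curve_cont (fun u => f u + g u)%C t.
Proof.
  intros Hf Hg eps He.
  destruct (Hf (eps / 2)) as [d1 [Hd1 H1]]; [lra|].
  destruct (Hg (eps / 2)) as [d2 [Hd2 H2]]; [lra|].
  exists (Rmin d1 d2). split; [now apply Rmin_glb_lt|]. intros u Hu.
  specialize (H1 u (Rlt_le_trans _ _ _ Hu (Rmin_l _ _))).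
  specialize (H2 u (Rlt_le_trans _ _ _ Hu (Rmin_r _ _))).
  replace (f u + g u - (f t + g t))%C with ((f u - f t) + (g u - g t))%C by ring.
  eapply Rle_lt_trans; [apply Cmod_triangle|]. lra.
Qed.

Lemma curve_cont_scal (c : C) (f : R -> C) (t : R) :
  curve_cont f t -> curve_cont (fun u => c * f u)%C t.
Proof.
  intros Hf eps He. assert (Hc := Cmod_ge_0 c).
  destruct (Hf (eps / (1 + Cmod c))) as [d [Hd H]].
  { apply Rdiv_lt_0_compat; lra. }
  exists d. split; [exact Hd|]. intros u Hu. specialize (H u Hu).
  replace (c * f u - c * f t)%C with (c * (f u - f t))%C by ring.
  rewrite Cmod_mult. assert (H0 := Cmod_ge_0 (f u - f t)%C).
  apply Rle_lt_trans with ((1 + Cmod c) * Cmod (f u - f t)%C); [nra|].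
  apply Rlt_le_trans with ((1 + Cmod c) * (eps / (1 + Cmod c))).
  - apply Rmult_lt_compat_l; lra.
  - apply Req_le. field. lra.
Qed.

Lemma curve_cont_minus (f g : R -> C) (t : R) :
  curve_cont f t -> curve_cont g t -> curve_cont (fun u => f u - g u)%C t.
Proof.
  intros Hf Hg. assert (H := curve_cont_plus _ _ _ Hf (curve_cont_scal (- (1))%C _ _ Hg)).
  intros eps He. destruct (H eps He) as [d [Hd H']].
  exists d. split; [exact Hd|]. intros u Hu.
  replace (f u - g u - (f t - g t))%C
    with ((f u + - (1) * g u - (f t + - (1) * g t)))%C by ring. auto.
Qed.

Lemma curve_cont_horizontal (f : C -> C) (x y : R) :
  Ccont f (x, y) -> curve_cont (fun u => f (u, y)) x.
Proof.
  intros H eps He. destruct (H eps He) as [d [Hd H']].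
  exists d. split; [exact Hd|]. intros u Hu.
  replace (u, y) with ((x, y) + RtoC (u - x))%C.
  - apply H'. now rewrite Cmod_R.
  - unfold Cplus, RtoC; simpl. f_equal; ring.
Qed.

Lemma curve_cont_vertical (f : C -> C) (x y : R) :
  Ccont f (x, y) -> curve_cont (fun u => f (x, u)) y.
Proof.
  intros H eps He. destruct (H eps He) as [d [Hd H']].
  exists d. split; [exact Hd|]. intros u Hu.
  replace (x, u) with ((x, y) + Ci * RtoC (u - y))%C.
  - apply H'. rewrite Cmod_mult, Cmod_Ci, Cmod_R. lra.
  - unfold Cplus, Cmult, Ci, RtoC; simpl. f_equal; ring.
Qed.

Definition curve_cont_on (phi : R -> C) (a b : R) : Prop :=
  forall t, a <= t <= b -> curve_cont phi t.

Lemma ex_RInt_Re (phi : R -> C) (a b : R) : a <= b -> curve_cont_on phi a b ->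
  ex_RInt (fun t => Re (phi t)) a b.
Proof.
  intros Hab H. apply (@ex_RInt_continuous R_CompleteNormedModule).
  rewrite Rmin_left, Rmax_right by lra.
  intros z Hz. now apply curve_cont_Re, H.
Qed.

Lemma ex_RInt_Im (phi : R -> C) (a b : R) : a <= b -> curve_cont_on phi a b ->
  ex_RInt (fun t => Im (phi t)) a b.
Proof.
  intros Hab H. apply (@ex_RInt_continuous R_CompleteNormedModule).
  rewrite Rmin_left, Rmax_right by lra.
  intros z Hz. now apply curve_cont_Im, H.
Qed.

Lemma CInt_ext (f g : R -> C) (a b : R) : a <= b ->
  (forall t, a <= t <= b -> f t = g t) -> CInt f a b = CInt g a b.
Proof.
  intros Hab H. unfold CInt. f_equal; apply RInt_ext;
  rewrite Rmin_left, Rmax_right by lra; intros x Hx; rewrite H by lra; reflexivity.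
Qed.

Lemma CInt_plus (f g : R -> C) (a b : R) : a <= b ->
  curve_cont_on f a b -> curve_cont_on g a b ->
  CInt (fun t => f t + g t)%C a b = (CInt f a b + CInt g a b)%C.
Proof.
  intros Hab Hf Hg. unfold CInt, Cplus; simpl. f_equal.
  - rewrite <- (RInt_plus (V := R_CompleteNormedModule)) by now apply ex_RInt_Re. reflexivity.
  - rewrite <- (RInt_plus (V := R_CompleteNormedModule)) by now apply ex_RInt_Im. reflexivity.
Qed.

Lemma CInt_scal (c : C) (f : R -> C) (a b : R) : a <= b -> curve_cont_on f a b ->
  CInt (fun t => c * f t)%C a b = (c * CInt f a b)%C.
Proof.
  intros Hab Hf. destruct c as [x y]. unfold CInt, Cmult; simpl.
  assert (HR := ex_RInt_Re f a b Hab Hf). assert (HI := ex_RInt_Im f a b Hab Hf).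
  assert (E : forall (k : R) (g : R -> R), ex_RInt g a b ->
    k * RInt g a b = RInt (fun t => k * g t) a b).
  { intros k g Hg. symmetry. exact (RInt_scal (V := R_CompleteNormedModule) g a b k Hg). }
  assert (X : forall (k : R) (g : R -> R), ex_RInt g a b -> ex_RInt (fun t => k * g t) a b).
  { intros k g Hg. exact (ex_RInt_scal (V := R_CompleteNormedModule) g a b k Hg). }
  f_equal; rewrite !E by assumption.
  - exact (RInt_minus (V := R_CompleteNormedModule) _ _ a b (X x _ HR) (X y _ HI)).
  - exact (RInt_plus (V := R_CompleteNormedModule) _ _ a b (X x _ HI) (X y _ HR)).
Qed.

Lemma CInt_minus (f g : R -> C) (a b : R) : a <= b ->
  curve_cont_on f a b -> curve_cont_on g a b ->
  CInt (fun t => f t - g t)%C a b = (CInt f a b - CInt g a b)%C.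
Proof.
  intros Hab Hf Hg.
  transitivity (CInt (fun t => f t + (- (1)) * g t)%C a b).
  - apply CInt_ext; [assumption|]. intros t _. ring.
  - rewrite CInt_plus, CInt_scal; [ring|assumption..|].
    intros t Ht. now apply curve_cont_scal, Hg.
Qed.

Lemma CInt_const (c : C) (a b : R) : CInt (fun _ => c) a b = (RtoC (b - a) * c)%C.
Proof.
  destruct c as [x y]. unfold CInt, Cmult, RtoC; simpl.
  rewrite !RInt_const. unfold scal; simpl; unfold mult; simpl. f_equal; ring.
Qed.

Lemma CInt_Chasles (f : R -> C) (a b c : R) : a <= b -> b <= c ->
  curve_cont_on f a c -> CInt f a c = (CInt f a b + CInt f b c)%C.
Proof.
  intros Hab Hbc H.
  assert (H1 : curve_cont_on f a b) by (intros t Ht; apply H; lra).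
  assert (H2 : curve_cont_on f b c) by (intros t Ht; apply H; lra).
  unfold CInt, Cplus; simpl. f_equal; symmetry.
  - exact (RInt_Chasles (V := R_CompleteNormedModule) _ a b c
      (ex_RInt_Re f a b Hab H1) (ex_RInt_Re f b c Hbc H2)).
  - exact (RInt_Chasles (V := R_CompleteNormedModule) _ a b c
      (ex_RInt_Im f a b Hab H1) (ex_RInt_Im f b c Hbc H2)).
Qed.

(* Rotating the integral onto the positive real axis reduces the bound to real integrands. *)
Lemma Cmod_CInt_le (f : R -> C) (g : R -> R) (a b : R) : a <= b ->
  curve_cont_on f a b -> ex_RInt g a b ->
  (forall t, a <= t <= b -> Cmod (f t) <= g t) -> Cmod (CInt f a b) <= RInt g a b.
Proof.
  intros Hab Hf Hg H.
  set (I := CInt f a b).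
  assert (H0 : 0 <= Cmod I) by apply Cmod_ge_0.
  destruct (Req_dec (Cmod I) 0) as [E|E].
  { rewrite E. apply RInt_ge_0; try assumption.
    intros t Ht. eapply Rle_trans; [apply Cmod_ge_0|apply H; lra]. }
  set (u := (Cconj I / RtoC (Cmod I))%C).
  assert (EC : RtoC (Cmod I) <> 0%C) by (intros Q; now apply RtoC_inj in Q).
  assert (Hu : Cmod u = 1).
  { unfold u. rewrite Cmod_div by assumption. rewrite Cmod_conj, Cmod_R, Rabs_pos_eq by lra.
    field. assumption. }
  assert (HuI : (u * I)%C = RtoC (Cmod I)).
  { unfold u.
    replace (Cconj I / RtoC (Cmod I) * I)%C with ((I * Cconj I) / RtoC (Cmod I))%C by (field; assumption).
    rewrite <- Cmod2_conj. simpl pow. rewrite !RtoC_mult. field. assumption. }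
  assert (Hc : curve_cont_on (fun t => u * f t)%C a b).
  { intros t Ht. now apply curve_cont_scal, Hf. }
  replace (Cmod I) with (RInt (fun t => Re (u * f t)%C) a b).
  - apply RInt_le; try assumption.
    + now apply ex_RInt_Re.
    + intros t Ht. eapply Rle_trans; [apply Rle_abs|].
      eapply Rle_trans; [apply re_le_Cmod|]. rewrite Cmod_mult, Hu, Rmult_1_l. apply H; lra.
  - change (Re (CInt (fun t => u * f t)%C a b) = Cmod I).
    rewrite CInt_scal by assumption. fold I. rewrite HuI. reflexivity.
Qed.

Lemma Cmod_CInt_le_const (f : R -> C) (M : R) (a b : R) : a <= b ->
  curve_cont_on f a b ->
  (forall t, a <= t <= b -> Cmod (f t) <= M) -> Cmod (CInt f a b) <= (b - a) * M.
Proof.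
  intros Hab Hf H.
  replace ((b - a) * M) with (RInt (fun _ => M) a b).
  - apply Cmod_CInt_le; try assumption. apply ex_RInt_const.
  - rewrite RInt_const. reflexivity.
Qed.

(** * Goursat's theorem on rectangles *)

(** The boundary integral over [a,b] x [c,d], counterclockwise, with opposite sides paired under one
    integral. *)
Definition rect_int (h : C -> C) (a b c d : R) : C :=
  (CInt (fun x => h (x, c) - h (x, d)) a b
   + Ci * CInt (fun y => h (b, y) - h (a, y)) c d)%C.

Definition holo_on_rect (h : C -> C) (a b c d : R) : Prop :=
  forall x y, a <= x <= b -> c <= y <= d -> exists l, Cder h (x, y) l.

Lemma holo_rect_sub (h : C -> C) (a b c d a' b' c' d' : R) :
  holo_on_rect h a b c d -> a <= a' -> b' <= b -> c <= c' -> d' <= d ->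
  holo_on_rect h a' b' c' d'.
Proof. intros H ? ? ? ? x y Hx Hy. apply H; lra. Qed.

Lemma holo_rect_horizontal (h : C -> C) (a b c d y : R) :
  holo_on_rect h a b c d -> c <= y <= d -> curve_cont_on (fun x => h (x, y)) a b.
Proof.
  intros H Hy x Hx. destruct (H x y Hx Hy) as [l Hl].
  exact (curve_cont_horizontal h x y (Cder_cont _ _ _ Hl)).
Qed.

Lemma holo_rect_vertical (h : C -> C) (a b c d x : R) :
  holo_on_rect h a b c d -> a <= x <= b -> curve_cont_on (fun y => h (x, y)) c d.
Proof.
  intros H Hx y Hy. destruct (H x y Hx Hy) as [l Hl].
  exact (curve_cont_vertical h x y (Cder_cont _ _ _ Hl)).
Qed.

Lemma curve_cont_on_minus (f g : R -> C) (a b : R) :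
  curve_cont_on f a b -> curve_cont_on g a b -> curve_cont_on (fun t => f t - g t)%C a b.
Proof. intros Hf Hg t Ht. apply curve_cont_minus; [now apply Hf|now apply Hg]. Qed.

Lemma rect_int_split_x (h : C -> C) (a m b c d : R) : a <= m -> m <= b -> c <= d ->
  holo_on_rect h a b c d ->
  rect_int h a b c d = (rect_int h a m c d + rect_int h m b c d)%C.
Proof.
  intros Ham Hmb Hcd H. unfold rect_int.
  rewrite (CInt_Chasles _ a m b) by (try assumption;
    apply curve_cont_on_minus; eapply holo_rect_horizontal; try exact H; lra).
  rewrite (CInt_ext (fun y => h (b, y) - h (a, y))%C
     (fun y => (h (m, y) - h (a, y)) + (h (b, y) - h (m, y)))%C c d)
     by (try assumption; intros; ring).
  rewrite CInt_plus by (try assumption;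
    apply curve_cont_on_minus; eapply holo_rect_vertical; try exact H; lra).
  ring.
Qed.

Lemma rect_int_split_y (h : C -> C) (a b c m d : R) : a <= b -> c <= m -> m <= d ->
  holo_on_rect h a b c d ->
  rect_int h a b c d = (rect_int h a b c m + rect_int h a b m d)%C.
Proof.
  intros Hab Hcm Hmd H. unfold rect_int.
  rewrite (CInt_Chasles _ c m d) by (try assumption;
    apply curve_cont_on_minus; eapply holo_rect_vertical; try exact H; lra).
  rewrite (CInt_ext (fun x => h (x, c) - h (x, d))%C
     (fun x => (h (x, c) - h (x, m)) + (h (x, m) - h (x, d)))%C a b)
     by (try assumption; intros; ring).
  rewrite CInt_plus by (try assumption;
    apply curve_cont_on_minus; eapply holo_rect_horizontal; try exact H; lra).
  ring.
Qed.

(** Between opposite sides the linear model changes by a constant, l times the displacement. The two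
    pairs of sides contribute -i l (b-a)(d-c) and +i l (b-a)(d-c), which cancel; what is left is the
    error term [e], at most eps times the half-perimeter. *)
Lemma rect_int_near_linear (h : C -> C) (a b c d eps : R) (z l : C) :
  a <= b -> c <= d -> 0 < eps -> holo_on_rect h a b c d ->
  a <= Re z <= b -> c <= Im z <= d ->
  (forall x y, a <= x <= b -> c <= y <= d ->
    Cmod (h (x, y) - h z - l * ((x, y) - z))%C <= eps * Cmod ((x, y) - z)%C) ->
  Cmod (rect_int h a b c d) <= 2 * eps * ((b - a) + (d - c)) ^ 2.
Proof.
  intros Hab Hcd He H Hzr Hzi Hlin.
  set (s := (b - a) + (d - c)).
  assert (Hs : 0 <= s) by (unfold s; lra).
  set (e := fun w : C => (h w - h z - l * (w - z))%C).
  assert (Be : forall x y, a <= x <= b -> c <= y <= d -> Cmod (e (x, y)) <= eps * s).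
  { intros x y Hx Hy. eapply Rle_trans; [apply Hlin; assumption|].
    apply Rmult_le_compat_l; [lra|]. eapply Rle_trans; [apply Cmod_le_Re_Im|].
    destruct z as [u v]. simpl in *. unfold s.
    apply Rplus_le_compat; apply Rabs_le; lra. }
  assert (Ce : forall f1 : R -> C, forall f2 : R -> C, forall p q : R, p <= q -> forall k : C,
     curve_cont_on (fun t => f1 t - f2 t)%C p q ->
     (forall t, p <= t <= q -> Cmod (f1 t - f2 t - k)%C <= 2 * (eps * s)) ->
     Cmod (CInt (fun t => f1 t - f2 t)%C p q - RtoC (q - p) * k)%C <= (q - p) * (2 * (eps * s))).
  { intros f1 f2 p q Hpq k Hc Hb. rewrite <- CInt_const, <- CInt_minus; try assumption.
    - apply Cmod_CInt_le_const; try assumption.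
      apply curve_cont_on_minus; [assumption|]. intros t _; apply curve_cont_const.
    - intros t _; apply curve_cont_const. }
  assert (E1 : Cmod (CInt (fun x => h (x, c) - h (x, d)) a b - RtoC (b - a) * (l * (- Ci * RtoC (d - c))))%C
     <= (b - a) * (2 * (eps * s))).
  { apply Ce; [assumption| |].
    - apply curve_cont_on_minus; eapply holo_rect_horizontal; try exact H; lra.
    - intros x Hx.
      replace (h (x, c) - h (x, d) - l * (- Ci * RtoC (d - c)))%C
        with (e (x, c) + - e (x, d))%C.
      + eapply Rle_trans; [apply Cmod_triangle|]. rewrite Cmod_opp.
        assert (B1 := Be x c Hx ltac:(lra)). assert (B2 := Be x d Hx ltac:(lra)). lra.
      + unfold e. replace (x, c) with ((x, d) + - Ci * RtoC (d - c))%C at 2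
          by (unfold Cplus, Cmult, Copp, Ci, RtoC; simpl; f_equal; ring). ring. }
  assert (E2 : Cmod (CInt (fun y => h (b, y) - h (a, y)) c d - RtoC (d - c) * (l * RtoC (b - a)))%C
     <= (d - c) * (2 * (eps * s))).
  { apply Ce; [assumption| |].
    - apply curve_cont_on_minus; eapply holo_rect_vertical; try exact H; lra.
    - intros y Hy.
      replace (h (b, y) - h (a, y) - l * RtoC (b - a))%C
        with (e (b, y) + - e (a, y))%C.
      + eapply Rle_trans; [apply Cmod_triangle|]. rewrite Cmod_opp.
        assert (B1 := Be b y ltac:(lra) Hy). assert (B2 := Be a y ltac:(lra) Hy). lra.
      + unfold e. replace (b, y) with ((a, y) + RtoC (b - a))%C at 2
          by (unfold Cplus, RtoC; simpl; f_equal; ring). ring. }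
  unfold rect_int.
  set (I1 := CInt (fun x => h (x, c) - h (x, d))%C a b) in *.
  set (I2 := CInt (fun y => h (b, y) - h (a, y))%C c d) in *.
  replace (I1 + Ci * I2)%C
   with ((I1 - RtoC (b - a) * (l * (- Ci * RtoC (d - c))))
       + Ci * (I2 - RtoC (d - c) * (l * RtoC (b - a))))%C by ring.
  eapply Rle_trans; [apply Cmod_triangle|]. rewrite Cmod_mult, Cmod_Ci, Rmult_1_l.
  replace (2 * eps * s ^ 2) with ((b - a) * (2 * (eps * s)) + (d - c) * (2 * (eps * s)))
    by (unfold s; ring).
  lra.
Qed.

Lemma nested_intervals (a b : nat -> R) :
  (forall n, a n <= a (S n)) -> (forall n, b (S n) <= b n) -> (forall n, a n <= b n) ->
  exists l, forall n, a n <= l <= b n.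
Proof.
  intros Ha Hb Hab.
  assert (Ma : forall n m, (n <= m)%nat -> a n <= a m).
  { intros n m Hm. induction Hm as [|m Hm IH]; [lra|]. specialize (Ha m). lra. }
  assert (Mb : forall n m, (n <= m)%nat -> b m <= b n).
  { intros n m Hm. induction Hm as [|m Hm IH]; [lra|]. specialize (Hb m). lra. }
  assert (Mab : forall n m, a m <= b n).
  { intros n m. specialize (Ma m (Nat.max n m) ltac:(lia)).
    specialize (Mb n (Nat.max n m) ltac:(lia)). specialize (Hab (Nat.max n m)). lra. }
  destruct (completeness (fun x => exists n, x = a n)) as [l [L1 L2]].
  - exists (b 0%nat). intros x [n ->]. apply Mab.
  - exists (a 0%nat), 0%nat. reflexivity.
  - exists l. intros n. split.
    + apply L1. now exists n.
    + apply L2. intros x [m ->]. apply Mab.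
Qed.

(** Stated through the lower left corner and the side lengths, so that the bisection has only the
    corner to track: at stage n the sides are p/2^n and q/2^n. *)
Lemma exists_quarter (h : C -> C) (a c p q : R) : 0 <= p -> 0 <= q ->
  holo_on_rect h a (a + p) c (c + q) ->
  exists a' c', a <= a' /\ a' + p / 2 <= a + p /\ c <= c' /\ c' + q / 2 <= c + q /\
    Cmod (rect_int h a (a + p) c (c + q)) / 4
      <= Cmod (rect_int h a' (a' + p / 2) c' (c' + q / 2)).
Proof.
  intros Hp Hq H.
  set (m := a + p / 2). set (n := c + q / 2).
  assert (E : rect_int h a (a + p) c (c + q) =
    ((rect_int h a m c n + rect_int h a m n (c + q))
    + (rect_int h m (a + p) c n + rect_int h m (a + p) n (c + q)))%C).
  { rewrite (rect_int_split_x h a m (a + p) c (c + q)) by (unfold m; try lra; assumption).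
    f_equal; apply rect_int_split_y; try (unfold m, n; lra);
    apply (holo_rect_sub _ _ _ _ _ _ _ _ _ H); unfold m, n; lra. }
  set (J := rect_int h a (a + p) c (c + q)) in *.
  assert (T1 := Cmod_triangle (rect_int h a m c n + rect_int h a m n (c + q))
     (rect_int h m (a + p) c n + rect_int h m (a + p) n (c + q))).
  rewrite <- E in T1.
  assert (T2 := Cmod_triangle (rect_int h a m c n) (rect_int h a m n (c + q))).
  assert (T3 := Cmod_triangle (rect_int h m (a + p) c n) (rect_int h m (a + p) n (c + q))).
  assert (Em : m + p / 2 = a + p) by (unfold m; field).
  assert (En : n + q / 2 = c + q) by (unfold n; field).
  destruct (Rle_dec (Cmod J / 4) (Cmod (rect_int h a m c n))) as [L1|L1].
  { exists a, c. repeat split; try lra. exact L1. }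
  destruct (Rle_dec (Cmod J / 4) (Cmod (rect_int h a m n (c + q)))) as [L2|L2].
  { exists a, n. rewrite En. repeat split; try (unfold n; lra). exact L2. }
  destruct (Rle_dec (Cmod J / 4) (Cmod (rect_int h m (a + p) c n))) as [L3|L3].
  { exists m, c. rewrite Em. repeat split; try (unfold m; lra). exact L3. }
  apply Rnot_le_lt in L1, L2, L3.
  exists m, n. rewrite Em, En. repeat split; try (unfold m, n; lra). lra.
Qed.

Lemma pow_half_small (K d : R) : 0 < d -> exists n, K / 2 ^ n < d.
Proof.
  intros Hd. destruct (Rle_dec K 0) as [HK|HK].
  { exists 0%nat. simpl. lra. }
  destruct (pow_lt_1_zero (1 / 2) ltac:(rewrite Rabs_pos_eq; lra) (d / K)
    ltac:(apply Rdiv_lt_0_compat; lra)) as [n Hn].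
  exists n. specialize (Hn n (le_n n)).
  assert (P : 0 < 2 ^ n) by (apply pow_lt; lra).
  assert (E : (1 / 2) ^ n = / 2 ^ n) by (rewrite <- pow_inv; f_equal; field).
  rewrite E, Rabs_pos_eq in Hn by now apply Rlt_le, Rinv_0_lt_compat.
  unfold Rdiv at 1. apply Rmult_lt_compat_l with (r := K) in Hn; [|lra].
  replace (K * (d / K)) with d in Hn by (field; lra). exact Hn.
Qed.

Theorem Goursat (h : C -> C) (a b c d : R) : a <= b -> c <= d ->
  holo_on_rect h a b c d -> rect_int h a b c d = 0%C.
Proof.
  intros Hab Hcd H.
  set (p := b - a). set (q := d - c).
  assert (Hp : 0 <= p) by (unfold p; lra). assert (Hq : 0 <= q) by (unfold q; lra).
  replace b with (a + p) in * by (unfold p; ring).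
  replace d with (c + q) in * by (unfold q; ring).
  clearbody p q. clear Hab Hcd.
  set (inside := fun n (s : R * R) => a <= fst s /\ fst s + p / 2 ^ n <= a + p /\
     c <= snd s /\ snd s + q / 2 ^ n <= c + q).
  set (J := fun n (s : R * R) => Cmod (rect_int h (fst s) (fst s + p / 2 ^ n) (snd s) (snd s + q / 2 ^ n))).
  assert (P2 : forall n, 0 < 2 ^ n) by (intros n; apply pow_lt; lra).
  assert (Hpn : forall n, 0 <= p / 2 ^ n) by (intros n; apply Rdiv_le_0_compat; auto).
  assert (Hqn : forall n, 0 <= q / 2 ^ n) by (intros n; apply Rdiv_le_0_compat; auto).
  assert (Hhalf : forall x n, x / 2 ^ S n = x / 2 ^ n / 2).
  { intros x n. simpl. field. apply Rgt_not_eq, P2. }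
  (* The next corner is chosen for every pair s, with a property conditional on [inside n s]; the
     recursion [sq] can then be defined before the invariant is proved. *)
  assert (step : forall n (s : R * R), {s' : R * R | inside n s ->
     fst s <= fst s' /\ fst s' + p / 2 ^ S n <= fst s + p / 2 ^ n /\
     snd s <= snd s' /\ snd s' + q / 2 ^ S n <= snd s + q / 2 ^ n /\
     J n s / 4 <= J (S n) s'}).
  { intros n s. apply constructive_indefinite_description.
    destruct (excluded_middle_informative (inside n s)) as [I|I].
    - destruct I as [I1 [I2 [I3 I4]]].
      destruct (exists_quarter h (fst s) (snd s) (p / 2 ^ n) (q / 2 ^ n)) as [a' [c' Q]]; auto.
      { apply (holo_rect_sub _ _ _ _ _ _ _ _ _ H); lra. }
      exists (a', c'). intros _. unfold J. simpl fst; simpl snd. rewrite !Hhalf. exact Q.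
    - exists s. tauto. }
  set (sq := fix sq n := match n with O => (a, c) | S n => proj1_sig (step n (sq n)) end).
  assert (Hin : forall n, inside n (sq n)).
  { induction n as [|n IH].
    - unfold inside; simpl. rewrite !Rdiv_1_r. lra.
    - assert (S1 := proj2_sig (step n (sq n)) IH).
      change (proj1_sig (step n (sq n))) with (sq (S n)) in S1.
      unfold inside in *. lra. }
  assert (Hst : forall n, fst (sq n) <= fst (sq (S n)) /\
     fst (sq (S n)) + p / 2 ^ S n <= fst (sq n) + p / 2 ^ n /\
     snd (sq n) <= snd (sq (S n)) /\ snd (sq (S n)) + q / 2 ^ S n <= snd (sq n) + q / 2 ^ n /\
     J n (sq n) / 4 <= J (S n) (sq (S n))).
  { intros n. exact (proj2_sig (step n (sq n)) (Hin n)). }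
  destruct (nested_intervals (fun n => fst (sq n)) (fun n => fst (sq n) + p / 2 ^ n)) as [u Hu].
  { intros n. apply Hst. } { intros n. apply Hst. } { intros n. specialize (Hpn n). lra. }
  destruct (nested_intervals (fun n => snd (sq n)) (fun n => snd (sq n) + q / 2 ^ n)) as [v Hv].
  { intros n. apply Hst. } { intros n. apply Hst. } { intros n. specialize (Hqn n). lra. }
  assert (HJ : forall n, Cmod (rect_int h a (a + p) c (c + q)) / 4 ^ n <= J n (sq n)).
  { induction n as [|n IH].
    - unfold J; simpl. rewrite !Rdiv_1_r. lra.
    - destruct (Hst n) as [_ [_ [_ [_ S4]]]].
      replace (Cmod (rect_int h a (a + p) c (c + q)) / 4 ^ S n)
        with (Cmod (rect_int h a (a + p) c (c + q)) / 4 ^ n / 4)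
        by (simpl; field; apply pow_nonzero; lra).
      lra. }
  assert (Hz : exists l, Cder h (u, v) l).
  { apply H.
    - specialize (Hu 0%nat). simpl in Hu. rewrite Rdiv_1_r in Hu. exact Hu.
    - specialize (Hv 0%nat). simpl in Hv. rewrite Rdiv_1_r in Hv. exact Hv. }
  destruct Hz as [l Hl].
  (* The 4^n lost by bisecting n times cancels against the square of the sides halved n times, so
     the bound no longer depends on n. *)
  assert (Small : forall eps, 0 < eps ->
    Cmod (rect_int h a (a + p) c (c + q)) <= 2 * eps * (p + q) ^ 2).
  { intros eps He. destruct (Hl eps He) as [del [Hdel Hd]].
    destruct (pow_half_small (p + q) del Hdel) as [n Hn].
    assert (B := rect_int_near_linear h (fst (sq n)) (fst (sq n) + p / 2 ^ n)
       (snd (sq n)) (snd (sq n) + q / 2 ^ n) eps (u, v) l).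
    assert (B' : J n (sq n) <= 2 * eps * (p / 2 ^ n + q / 2 ^ n) ^ 2).
    { unfold J.
      replace (p / 2 ^ n + q / 2 ^ n) with (fst (sq n) + p / 2 ^ n - fst (sq n) +
        (snd (sq n) + q / 2 ^ n - snd (sq n))) by ring.
      specialize (Hpn n). specialize (Hqn n).
      destruct (Hin n) as [I1 [I2 [I3 I4]]].
      apply B; try lra; auto.
      - apply (holo_rect_sub _ _ _ _ _ _ _ _ _ H); lra.
      - intros x y Hx Hy.
        replace (h (x, y)) with (h ((u, v) + ((x, y) - (u, v)))%C).
        + apply Hd. eapply Rle_lt_trans; [apply Cmod_le_Re_Im|].
          eapply Rle_lt_trans; [|exact Hn].
          replace ((p + q) / 2 ^ n) with (p / 2 ^ n + q / 2 ^ n) by (field; apply Rgt_not_eq, P2).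
          specialize (Hu n). specialize (Hv n). simpl in *.
          apply Rplus_le_compat; apply Rabs_le; lra.
        + f_equal. ring. }
    specialize (HJ n).
    assert (P4 : 4 ^ n = 2 ^ n * 2 ^ n).
    { rewrite <- Rpow_mult_distr. now replace (2 * 2) with 4 by ring. }
    specialize (P2 n).
    replace (2 * eps * (p / 2 ^ n + q / 2 ^ n) ^ 2) with (2 * eps * (p + q) ^ 2 / 4 ^ n) in B'
      by (rewrite P4; field; lra).
    apply Rmult_le_reg_r with (/ 4 ^ n).
    - apply Rinv_0_lt_compat, pow_lt. lra.
    - unfold Rdiv in *. lra. }
  apply Cmod_eq_0. apply Rle_antisym; [|apply Cmod_ge_0].
  apply le_epsilon. intros e He.
  set (K := 2 * (p + q) ^ 2 + 1).
  assert (HK : 1 <= K) by (unfold K; nra).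
  assert (E := Small (e / K) ltac:(apply Rdiv_lt_0_compat; lra)).
  apply Rle_trans with (1 := E). rewrite Rplus_0_l.
  replace (2 * (e / K) * (p + q) ^ 2) with (e * ((2 * (p + q) ^ 2) / K)) by (field; lra).
  rewrite <- (Rmult_1_r e) at 2. apply Rmult_le_compat_l; [lra|].
  apply Rle_div_l; [lra|unfold K; lra].
Qed.

(** * Approximation by Dirichlet polynomials *)

Fixpoint csum (u : nat -> C) (n : nat) : C :=
  match n with O => 0%C | S n => (csum u n + u n)%C end.

Lemma sum_n_csum (u : nat -> C) (n : nat) :
  @sum_n C_NormedModule u n = csum u (S n).
Proof.
  induction n as [|n IH].
  - rewrite sum_O. simpl. now rewrite Cplus_0_l.
  - rewrite sum_Sn, IH. reflexivity.
Qed.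

Lemma is_series_csum (u : nat -> C) (l : C) :
  @is_series C_AbsRing C_NormedModule u l <->
  (forall eps, 0 < eps -> exists N, forall n, (N <= n)%nat -> Cmod (csum u n - l)%C < eps).
Proof.
  eapply iff_trans.
  { apply (@filterlim_locally_ball_norm C_AbsRing nat C_NormedModule eventually _ (sum_n u) l). }
  split.
  - intros H eps He. destruct (H (mkposreal eps He)) as [N HN].
    exists (S N). intros n Hn. destruct n as [|n]; [lia|].
    specialize (HN n ltac:(lia)). rewrite sum_n_csum in HN. exact HN.
  - intros H eps. destruct (H eps (cond_pos eps)) as [N HN].
    exists N. intros n Hn. rewrite sum_n_csum. apply (HN (S n)). lia.
Qed.

Lemma bounded_prefix (u : nat -> R) (N : nat) : exists B, forall n, (n < N)%nat -> u n <= B.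
Proof.
  induction N as [|N [B IH]].
  - exists 0. intros n Hn. lia.
  - exists (Rmax B (u N)). intros n Hn. destruct (Nat.eq_dec n N) as [->|E].
    + apply Rmax_r.
    + eapply Rle_trans; [apply IH; lia|apply Rmax_l].
Qed.

Lemma series_terms_bounded (u : nat -> C) (l : C) :
  @is_series C_AbsRing C_NormedModule u l -> exists B, forall k, Cmod (u k) <= B.
Proof.
  rewrite is_series_csum. intros H. destruct (H 1 Rlt_0_1) as [N HN].
  destruct (bounded_prefix (fun k => Cmod (u k)) N) as [B HB].
  exists (Rmax B 2). intros k. destruct (Nat.lt_ge_cases k N) as [L|L].
  - eapply Rle_trans; [apply HB, L|apply Rmax_l].
  - eapply Rle_trans; [|apply Rmax_r].
    assert (H1 := HN k L). assert (H2 := HN (S k) ltac:(lia)). simpl in H2.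
    replace (u k) with ((csum u k + u k - l) + - (csum u k - l))%C by ring.
    eapply Rle_trans; [apply Cmod_triangle|]. rewrite Cmod_opp. lra.
Qed.

(** Since B/(M+1)^2 <= B/M - B/(M+1), the bounds on the terms telescope. *)
Lemma csum_quadratic_tail (u : nat -> C) (l : C) (B : R) : 0 <= B ->
  @is_series C_AbsRing C_NormedModule u l ->
  (forall k, Cmod (u k) <= B / INR (S k) ^ 2) ->
  forall N, (1 <= N)%nat -> Cmod (l - csum u N)%C <= B / INR N.
Proof.
  intros HB Hs Hu N HN.
  assert (Pos : forall n, (1 <= n)%nat -> 0 < INR n) by (intros n Hn; now apply lt_0_INR).
  assert (T : forall M, (N <= M)%nat -> Cmod (csum u M - csum u N)%C <= B / INR N - B / INR M).
  { intros M HM. induction HM as [|M HM IH].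
    - replace (csum u N - csum u N)%C with (RtoC 0) by ring. rewrite Cmod_0. lra.
    - simpl csum. replace (csum u M + u M - csum u N)%C with ((csum u M - csum u N) + u M)%C by ring.
      eapply Rle_trans; [apply Cmod_triangle|].
      assert (Hk := Hu M). assert (PM := Pos M ltac:(lia)).
      assert (D : B / INR (S M) ^ 2 <= B / INR M - B / INR (S M)).
      { rewrite S_INR.
        replace (B / INR M - B / (INR M + 1)) with (B / (INR M * (INR M + 1))) by (field; lra).
        unfold Rdiv. apply Rmult_le_compat_l; [lra|]. apply Rinv_le_contravar; nra. }
      lra. }
  apply le_epsilon. intros eps He.
  rewrite is_series_csum in Hs. destruct (Hs eps He) as [N0 HN0].
  set (M := Nat.max N N0). specialize (HN0 M ltac:(lia)). specialize (T M ltac:(lia)).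
  replace (l - csum u N)%C with ((csum u M - csum u N) + - (csum u M - l))%C by ring.
  eapply Rle_trans; [apply Cmod_triangle|]. rewrite Cmod_opp.
  assert (0 <= B / INR M). { apply Rdiv_le_0_compat; [lra|]. apply Pos. lia. }
  lra.
Qed.

(** Convergence at the real point sigma + 1 bounds the terms there. Two units further to the right
    each term gains a factor (k+1)^{-2}, whence a tail O(1/N) that is uniform in the half-plane. *)
Lemma dirichlet_tail (f : C -> C) (a : nat -> C) (sigma : R) :
  (forall s, half_plane sigma s -> dirichlet_sum a s (f s)) ->
  exists B, 0 <= B /\ forall w N, (1 <= N)%nat -> sigma + 3 <= Re w ->
    Cmod (f w - csum (fun k => a (S k) * nat_cpow (S k) (- w)) N)%C <= B / INR N.
Proof.
  intros H.
  set (s0 := RtoC (sigma + 1)).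
  assert (Hs0 : half_plane sigma s0) by (unfold half_plane, s0; simpl; lra).
  destruct (series_terms_bounded _ _ (H s0 Hs0)) as [B HB].
  exists B. split; [eapply Rle_trans; [apply Cmod_ge_0|apply (HB 0%nat)]|].
  intros w N HN Hw. apply csum_quadratic_tail; try assumption.
  - eapply Rle_trans; [apply Cmod_ge_0|apply (HB 0%nat)].
  - apply H. unfold half_plane. lra.
  - intros k. specialize (HB k).
    set (L := ln (INR (S k))).
    assert (HL : 0 <= L) by (apply ln_INR_ge_0; lia).
    rewrite Cmod_mult, Cmod_nat_cpow in HB |- *. fold L in HB |- *.
    replace (L * Re (- w)) with (L * Re (- s0) + (- (L * (Re w - (sigma + 1)))))
      by (destruct w; unfold s0; simpl; ring).
    rewrite exp_plus, <- Rmult_assoc. unfold Rdiv.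
    apply Rmult_le_compat; try assumption.
    + apply Rmult_le_pos; [apply Cmod_ge_0|apply Rlt_le, exp_pos].
    + apply Rlt_le, exp_pos.
    + rewrite exp_Ropp. apply Rinv_le_contravar.
      * apply pow_lt, lt_0_INR. lia.
      * replace (INR (S k) ^ 2) with (exp (L * 2)).
        -- destruct (Req_dec (L * 2) (L * (Re w - (sigma + 1)))) as [->|E]; [lra|].
           apply Rlt_le, exp_increasing. nra.
        -- replace (L * 2) with (L + L) by ring. rewrite exp_plus. unfold L.
           rewrite exp_ln by (apply lt_0_INR; lia). ring.
Qed.

Lemma CInt_csum (u : nat -> R -> C) (p q : R) (N : nat) : p <= q ->
  (forall k, curve_cont_on (u k) p q) ->
  curve_cont_on (fun y => csum (fun k => u k y) N) p q /\
  CInt (fun y => csum (fun k => u k y) N) p q = csum (fun k => CInt (u k) p q) N.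
Proof.
  intros Hpq Hu. induction N as [|N [IH1 IH2]]; simpl.
  - split; [intros t _; apply curve_cont_const|]. rewrite CInt_const. ring.
  - split.
    + intros t Ht. apply curve_cont_plus; [now apply IH1|now apply Hu].
    + rewrite CInt_plus; try assumption; [now rewrite IH2|apply Hu].
Qed.

(* A polynomial approximate identity: nonnegative on the imaginary segment [-iT, iT], exponentially
   small in M on the horizontal sides of the rectangle, so that no improper integral occurs. *)
Definition kernel (T : R) (M : nat) (v : C) : C := ((1 + v * v * RtoC (/ (T * T))) ^ M)%C.

Lemma Cder_pow (f : C -> C) (z : C) (M : nat) :
  (exists l, Cder f z l) -> exists l, Cder (fun w => f w ^ M)%C z l.
Proof.
  intros [l Hl]. induction M as [|M [m IH]].
  - exists 0%C. exact (Cder_const 1%C z).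
  - eexists. apply (Cder_ext (fun w => f w * f w ^ M)%C).
    + intros w. now rewrite Cpow_S.
    + apply (Cder_mult f (fun w => f w ^ M)%C z l m); assumption.
Qed.

Lemma Cder_kernel (T : R) (M : nat) (z : C) : exists l, Cder (kernel T M) z l.
Proof.
  apply Cder_pow. eexists.
  apply (Cder_plus (fun _ => 1%C)); [apply Cder_const|].
  apply (Cder_mult (fun v => v * v)%C (fun _ => RtoC (/ (T * T)))); [|apply Cder_const].
  apply Cder_mult; apply Cder_id.
Qed.

Lemma kernel_imaginary (T : R) (M : nat) (y : R) :
  kernel T M (0, y) = RtoC ((1 - y ^ 2 / T ^ 2) ^ M).
Proof.
  unfold kernel. rewrite RtoC_pow. f_equal.
  unfold Cplus, Cmult, RtoC; simpl. f_equal; unfold Rdiv; rewrite ?Rmult_1_r; ring.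
Qed.

(** For v = x + iy with |y| = T = 4A one has v^2 + T^2 = x^2 + 2ixy, of modulus at most A^2 + 8 A^2;
    dividing by T^2 = 16 A^2 gives 9/16. *)
Lemma kernel_horizontal (A x y : R) (M : nat) : 0 < A -> 0 <= x <= A -> y ^ 2 = (4 * A) ^ 2 ->
  Cmod (kernel (4 * A) M (x, y)) <= (9 / 16) ^ M.
Proof.
  intros HA Hx Hy. unfold kernel. rewrite Cmod_pow. apply pow_incr.
  split; [apply Cmod_ge_0|].
  replace (1 + (x, y) * (x, y) * RtoC (/ (4 * A * (4 * A))))%C
    with (RtoC (1 / (16 * A * A)) * ((x, y) * (x, y) + RtoC (16 * A * A)))%C.
  2: { unfold Cplus, Cmult, RtoC; simpl. f_equal; field; lra. }
  rewrite Cmod_mult, Cmod_R, Rabs_pos_eq by (apply Rlt_le, Rdiv_lt_0_compat; nra).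
  assert (E : Cmod ((x, y) * (x, y) + RtoC (16 * A * A))%C <= 9 * A * A).
  { eapply Rle_trans; [apply Cmod_le_Re_Im|]. simpl.
    replace (x * x - y * y + 16 * A * A) with (x * x) by nra.
    replace (x * y + y * x + 0) with (2 * x * y) by ring.
    rewrite (Rabs_pos_eq (x * x)) by nra. rewrite Rabs_mult, (Rabs_pos_eq (2 * x)) by lra.
    assert (Hay : Rabs y = 4 * A).
    { rewrite <- (Rabs_pos_eq (4 * A)) by lra. apply Rsqr_eq_abs_0. unfold Rsqr. nra. }
    rewrite Hay. nra. }
  apply Rle_trans with (1 / (16 * A * A) * (9 * A * A)).
  - apply Rmult_le_compat_l; [apply Rlt_le, Rdiv_lt_0_compat; nra|exact E].
  - apply Req_le. field. lra.
Qed.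

(** Used on the right-hand line, where the truncation error, chosen after M, compensates any bound
    that depends on M alone. *)
Lemma kernel_crude (A x y : R) (M : nat) : 0 < A -> 0 <= x <= A -> - (4 * A) <= y <= 4 * A ->
  Cmod (kernel (4 * A) M (x, y)) <= 3 ^ M.
Proof.
  intros HA Hx Hy. unfold kernel. rewrite Cmod_pow. apply pow_incr.
  split; [apply Cmod_ge_0|].
  eapply Rle_trans; [apply Cmod_triangle|]. rewrite Cmod_1, !Cmod_mult, Cmod_R.
  rewrite Rabs_pos_eq by (apply Rlt_le, Rinv_0_lt_compat; nra).
  assert (E : Cmod (x, y) <= 5 * A).
  { eapply Rle_trans; [apply Cmod_le_Re_Im|]. simpl.
    assert (Rabs x <= A) by (apply Rabs_le; lra).
    assert (Rabs y <= 4 * A) by (apply Rabs_le; lra). lra. }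
  assert (E0 := Cmod_ge_0 (x, y)).
  apply Rle_trans with (1 + 25 * A * A * / (4 * A * (4 * A))).
  - apply Rplus_le_compat_l, Rmult_le_compat_r; [apply Rlt_le, Rinv_0_lt_compat; nra|nra].
  - replace (25 * A * A * / (4 * A * (4 * A))) with (25 / 16) by (field; lra). lra.
Qed.

Definition kernel_mass (T : R) (M : nat) : R := RInt (fun y => (1 - y ^ 2 / T ^ 2) ^ M) (- T) T.

Lemma ex_RInt_kernel (T : R) (M : nat) (a b : R) :
  ex_RInt (fun y => (1 - y ^ 2 / T ^ 2) ^ M) a b.
Proof.
  apply (@ex_RInt_continuous R_CompleteNormedModule). intros z _.
  apply (ex_derive_continuous (V := R_NormedModule)). auto_derive. trivial.
Qed.

Lemma kernel_base_range (T y : R) : 0 < T -> - T <= y <= T -> 0 <= 1 - y ^ 2 / T ^ 2 <= 1.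
Proof.
  intros HT Hy. assert (P : 0 < T ^ 2) by (apply pow_lt; lra).
  assert (0 <= y ^ 2 / T ^ 2) by (apply Rdiv_le_0_compat; nra).
  assert (y ^ 2 / T ^ 2 <= 1) by (apply Rle_div_l; nra).
  lra.
Qed.

Lemma kernel_base_antitone (T y z : R) : 0 < T -> y ^ 2 <= z ^ 2 ->
  1 - z ^ 2 / T ^ 2 <= 1 - y ^ 2 / T ^ 2.
Proof.
  intros HT H. assert (P : 0 < T ^ 2) by (apply pow_lt; lra).
  assert (y ^ 2 / T ^ 2 <= z ^ 2 / T ^ 2).
  { apply Rmult_le_compat_r; [apply Rlt_le, Rinv_0_lt_compat, P|exact H]. }
  lra.
Qed.

(** Only |y| <= eta/2 is kept. The base there is strictly larger than its values for |y| >= eta, so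
    for large M the mass dominates what the kernel carries away from 0. *)
Lemma kernel_mass_ge (T eta : R) (M : nat) : 0 < T -> 0 < eta <= T ->
  eta * (1 - (eta / 2) ^ 2 / T ^ 2) ^ M <= kernel_mass T M.
Proof.
  intros HT He. unfold kernel_mass.
  set (g := fun y => (1 - y ^ 2 / T ^ 2) ^ M).
  rewrite <- (RInt_Chasles (V := R_CompleteNormedModule) g (- T) (- (eta / 2)) T)
    by apply ex_RInt_kernel.
  rewrite <- (RInt_Chasles (V := R_CompleteNormedModule) g (- (eta / 2)) (eta / 2) T)
    by apply ex_RInt_kernel.
  assert (Pg : forall y, - T <= y <= T -> 0 <= g y).
  { intros y Hy. apply pow_le. apply (kernel_base_range T y HT Hy). }
  assert (R1 : 0 <= RInt g (- T) (- (eta / 2))).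
  { apply RInt_ge_0; [lra|apply ex_RInt_kernel|]. intros; apply Pg; lra. }
  assert (R3 : 0 <= RInt g (eta / 2) T).
  { apply RInt_ge_0; [lra|apply ex_RInt_kernel|]. intros; apply Pg; lra. }
  assert (R2 : eta * (1 - (eta / 2) ^ 2 / T ^ 2) ^ M <= RInt g (- (eta / 2)) (eta / 2)).
  { replace (eta * (1 - (eta / 2) ^ 2 / T ^ 2) ^ M)
      with (RInt (fun _ => (1 - (eta / 2) ^ 2 / T ^ 2) ^ M) (- (eta / 2)) (eta / 2)).
    - apply RInt_le; [lra|apply ex_RInt_const|apply ex_RInt_kernel|].
      intros y Hy. apply pow_incr. split.
      + apply kernel_base_range; lra.
      + apply kernel_base_antitone; [assumption|]. nra.
    - rewrite RInt_const. unfold scal; simpl; unfold mult; simpl. field. }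
  eapply Rle_trans; [exact R2|]. unfold plus; simpl. lra.
Qed.

(** A Dirichlet polynomial is a list of pairs (coefficient, frequency), repetitions allowed. The
    function chi stands in for n^{-s}, so the same list is evaluated at points of C_+, on the
    imaginary axis and at points of the polydisc. *)
Definition tsum (T : list (C * nat)) (chi : nat -> C) : C :=
  fold_right (fun p acc => fst p * chi (snd p) + acc)%C 0%C T.

Lemma tsum_app (T U : list (C * nat)) (chi : nat -> C) :
  tsum (T ++ U) chi = (tsum T chi + tsum U chi)%C.
Proof. induction T as [|p T IH]; simpl; [|rewrite IH]; ring. Qed.

Lemma csum_tsum (c : nat -> C) (chi : nat -> C) (N : nat) :
  csum (fun k => c k * chi (S k))%C N = tsum (map (fun k => (c k, S k)) (seq 0 N)) chi.
Proof.
  induction N as [|N IH]; [reflexivity|].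
  rewrite seq_S, map_app, tsum_app, <- IH. simpl. ring.
Qed.

Lemma csum_scal (c : C) (u : nat -> C) (N : nat) : (c * csum u N)%C = csum (fun k => c * u k)%C N.
Proof. induction N as [|N IH]; simpl; [|rewrite <- IH]; ring. Qed.

Lemma csum_ext (u v : nat -> C) (N : nat) : (forall k, u k = v k) -> csum u N = csum v N.
Proof. intros H. induction N as [|N IH]; simpl; [|rewrite IH, H]; reflexivity. Qed.

(** * Averages over vertical segments and the shift of the segment *)

Section Smoothing.

Variables (f : C -> C) (A : R) (M : nat).
Hypothesis f_holo : forall s, C_plus s -> exists l, Cder f s l.
Hypothesis f_le_1 : forall s, C_plus s -> Cmod (f s) <= 1.
Hypothesis A_pos : 0 < A.

Let T := 4 * A.

(** Up to the factor i, the integral of f(s + v) times the kernel from v = x - iT to v = x + iT: s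
    is fixed and the line x moves. *)
Definition smooth_line (s : C) (x : R) : C :=
  CInt (fun y => f (s + (x, y)) * kernel T M (x, y))%C (- T) T.

Lemma smooth_integrand_holo (s : C) (x y : R) : C_plus s -> 0 <= x ->
  exists l, Cder (fun v => f (s + v) * kernel T M v)%C (x, y) l.
Proof.
  intros Hs Hx.
  destruct (f_holo (s + (x, y))%C) as [l Hl].
  { unfold C_plus, half_plane in *. destruct s; simpl in *. lra. }
  destruct (Cder_kernel T M (x, y)) as [m Hm].
  eexists. apply (Cder_mult (fun v => f (s + v)%C)); [|exact Hm].
  apply (Cder_comp f (fun v => (s + v)%C) _ (0 + 1)%C); [|exact Hl].
  apply Cder_plus; [apply Cder_const|apply Cder_id].
Qed.

Lemma smooth_integrand_cont (s : C) (x : R) : C_plus s -> 0 <= x ->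
  curve_cont_on (fun y => f (s + (x, y)) * kernel T M (x, y))%C (- T) T.
Proof.
  intros Hs Hx y _. destruct (smooth_integrand_holo s x y Hs Hx) as [l Hl].
  exact (curve_cont_vertical _ x y (Cder_cont _ _ _ Hl)).
Qed.

(** As Re s > 0, the integrand is holomorphic on the closed rectangle [0,A] x [-T,T]. By Goursat the
    two vertical sides differ by the two horizontal ones, of length A, where the kernel is at most
    (9/16)^M. *)
Lemma smooth_shift (s : C) : C_plus s ->
  Cmod (smooth_line s A - smooth_line s 0)%C <= A * (2 * (9 / 16) ^ M).
Proof.
  intros Hs.
  set (h := fun v => (f (s + v) * kernel T M v)%C).
  assert (Hh : holo_on_rect h 0 A (- T) T).
  { intros x y Hx _. apply smooth_integrand_holo; [assumption|lra]. }
  assert (G := Goursat h 0 A (- T) T ltac:(lra) ltac:(unfold T; lra) Hh).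
  unfold rect_int in G.
  rewrite (CInt_minus (fun y => h (A, y)) (fun y => h (0, y))) in G.
  2: unfold T; lra.
  2,3: apply smooth_integrand_cont; try assumption; lra.
  change (CInt (fun y => h (A, y)) (- T) T) with (smooth_line s A) in G.
  change (CInt (fun y => h (0, y)) (- T) T) with (smooth_line s 0) in G.
  set (I := CInt (fun x => h (x, (- T)%R) - h (x, T))%C 0 A) in *.
  assert (E : Cmod (Ci * (smooth_line s A - smooth_line s 0))%C = Cmod I).
  { replace (Ci * (smooth_line s A - smooth_line s 0))%C with (- I)%C.
    - apply Cmod_opp.
    - transitivity (0 - I)%C; [ring|]. rewrite <- G. ring. }
  rewrite Cmod_mult, Cmod_Ci, Rmult_1_l in E. rewrite E.
  replace A with (A - 0) at 1 by ring.
  assert (Hb : forall x y, 0 <= x <= A -> y ^ 2 = T ^ 2 -> Cmod (h (x, y)) <= (9 / 16) ^ M).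
  { intros x y Hx Hy. unfold h. rewrite Cmod_mult, <- (Rmult_1_l ((9 / 16) ^ M)).
    apply Rmult_le_compat; try apply Cmod_ge_0.
    - apply f_le_1. unfold C_plus, half_plane in *. destruct s; simpl in *. lra.
    - apply kernel_horizontal; assumption. }
  apply Cmod_CInt_le_const; [lra| |].
  - apply curve_cont_on_minus; eapply holo_rect_horizontal; try exact Hh; unfold T; lra.
  - intros x Hx. eapply Rle_trans; [apply Cmod_triangle|]. rewrite Cmod_opp.
    assert (B1 := Hb x (- T) Hx ltac:(ring)). assert (B2 := Hb x T Hx ltac:(ring)). lra.
Qed.

Lemma smooth_line_0_le (s : C) : C_plus s -> Cmod (smooth_line s 0) <= kernel_mass T M.
Proof.
  intros Hs. apply Cmod_CInt_le; [unfold T; lra| |apply ex_RInt_kernel|].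
  - apply smooth_integrand_cont; [assumption|lra].
  - intros y Hy. rewrite Cmod_mult, kernel_imaginary, Cmod_R.
    assert (K := kernel_base_range T y ltac:(unfold T; lra) Hy).
    assert (P : 0 <= (1 - y ^ 2 / T ^ 2) ^ M) by (apply pow_le; lra).
    rewrite Rabs_pos_eq by assumption.
    rewrite <- (Rmult_1_l ((1 - y ^ 2 / T ^ 2) ^ M)) at 2.
    apply Rmult_le_compat_r; [assumption|].
    apply f_le_1. unfold C_plus, half_plane in *. destruct s; simpl in *. lra.
Qed.

(** The integrand is at most eps times the kernel for |y| < eta, and at most 2 Y^M elsewhere because
    |f| <= 1. The sum of the two bounds is valid on the whole segment and is integrated at once. *)
Lemma smooth_line_0_close (s : C) (eps eta : R) : C_plus s -> 0 < eps -> 0 < eta <= T ->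
  (forall y, Rabs y < eta -> Cmod (f (s + (0, y)) - f s)%C <= eps) ->
  Cmod (smooth_line s 0 - RtoC (kernel_mass T M) * f s)%C
    <= eps * kernel_mass T M + 2 * T * (2 * (1 - eta ^ 2 / T ^ 2) ^ M).
Proof.
  intros Hs He Heta Hc.
  assert (HT : 0 < T) by (unfold T; lra).
  assert (KC : curve_cont_on (fun y => kernel T M (0, y)) (- T) T).
  { intros y _. destruct (Cder_kernel T M (0, y)) as [l Hl].
    exact (curve_cont_vertical _ 0 y (Cder_cont _ _ _ Hl)). }
  assert (Em : RtoC (kernel_mass T M) = CInt (fun y => kernel T M (0, y)) (- T) T).
  { unfold CInt, RtoC. apply (f_equal2 (@pair R R)).
    - apply RInt_ext. intros y _. rewrite kernel_imaginary. reflexivity.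
    - transitivity (RInt (fun _ : R => 0) (- T) T).
      + rewrite RInt_const. unfold scal; simpl; unfold mult; simpl. ring.
      + apply RInt_ext. intros y _. rewrite kernel_imaginary. reflexivity. }
  rewrite Em, Cmult_comm, <- CInt_scal by (try assumption; lra).
  unfold smooth_line. rewrite <- CInt_minus; [|lra| |].
  2: apply smooth_integrand_cont; [assumption|lra].
  2: { intros y Hy. apply curve_cont_scal. now apply KC. }
  set (g := fun y => (1 - y ^ 2 / T ^ 2) ^ M).
  set (Y := (1 - eta ^ 2 / T ^ 2) ^ M).
  assert (Xg : ex_RInt g (- T) T) by apply ex_RInt_kernel.
  replace (eps * kernel_mass T M + 2 * T * (2 * Y))
    with (RInt (fun y => eps * g y + 2 * Y) (- T) T).
  2: { transitivity (RInt (fun y => eps * g y) (- T) T + RInt (fun _ => 2 * Y) (- T) T).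
       - exact (RInt_plus (V := R_CompleteNormedModule) (fun y => eps * g y) (fun _ => 2 * Y) (- T) T
           (ex_RInt_scal (V := R_CompleteNormedModule) g (- T) T eps Xg) (ex_RInt_const _ _ _)).
       - f_equal.
         + exact (RInt_scal (V := R_CompleteNormedModule) g (- T) T eps Xg).
         + rewrite RInt_const. unfold scal; simpl; unfold mult; simpl. ring. }
  assert (HY : 0 <= Y).
  { apply pow_le. apply kernel_base_range; lra. }
  apply Cmod_CInt_le; [lra| | |].
  - apply curve_cont_on_minus; [apply smooth_integrand_cont; [assumption|lra]|].
    intros y Hy. apply curve_cont_scal. now apply KC.
  - exact (ex_RInt_plus (V := R_CompleteNormedModule) (fun y => eps * g y) (fun _ => 2 * Y) (- T) T
           (ex_RInt_scal (V := R_CompleteNormedModule) g (- T) T eps Xg) (ex_RInt_const _ _ _)).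
  - intros y Hy. rewrite kernel_imaginary. fold (g y).
    replace (f (s + (0, y)) * RtoC (g y) - f s * RtoC (g y))%C
      with ((f (s + (0, y)) - f s) * RtoC (g y))%C by ring.
    assert (K := kernel_base_range T y ltac:(lra) Hy).
    assert (Pg : 0 <= g y) by (apply pow_le; lra).
    rewrite Cmod_mult, Cmod_R, Rabs_pos_eq by assumption.
    destruct (Rlt_le_dec (Rabs y) eta) as [L|L].
    + specialize (Hc y L). nra.
    + assert (B : Cmod (f (s + (0, y)) - f s)%C <= 2).
      { eapply Rle_trans; [apply Cmod_triangle|]. rewrite Cmod_opp.
        assert (B1 := f_le_1 s Hs).
        assert (B2 : Cmod (f (s + (0, y))%C) <= 1).
        { apply f_le_1. unfold C_plus, half_plane in *. destruct s; simpl in *. lra. }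
        lra. }
      assert (GY : g y <= Y).
      { apply pow_incr. split; [lra|]. apply kernel_base_antitone; [lra|].
        rewrite <- (pow2_abs y). apply pow_incr. lra. }
      assert (0 <= eps * g y) by (apply Rmult_le_pos; lra).
      assert (B0 := Cmod_ge_0 (f (s + (0, y)) - f s)%C). nra.
Qed.

(** From n^{-(s+v)} = n^{-s} n^{-v}, integrating the truncated series over v leaves a Dirichlet
    polynomial in s with coefficients a_n times the integral of n^{-v} against the kernel. *)
Lemma smooth_line_A_dirichlet (a : nat -> C) (B : R) (N : nat) (s : C) :
  C_plus s -> 0 <= B ->
  (forall w, A <= Re w -> Cmod (f w - csum (fun k => a (S k) * nat_cpow (S k) (- w)) N)%C <= B) ->
  Cmod (smooth_line s A - csum (fun k => a (S k)
      * CInt (fun y => nat_cpow (S k) (- (A, y)) * kernel T M (A, y)) (- T) T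
      * nat_cpow (S k) (- s)) N)%C
    <= 2 * T * (B * 3 ^ M).
Proof.
  intros Hs HB H.
  assert (HT : 0 < T) by (unfold T; lra).
  set (u := fun k y => (nat_cpow (S k) (- (A, y)) * kernel T M (A, y))%C).
  assert (Hu : forall k, curve_cont_on (u k) (- T) T).
  { intros k y _.
    destruct (Cder_nat_cpow_opp (S k) (A, y)) as [l Hl].
    destruct (Cder_kernel T M (A, y)) as [m Hm].
    exact (curve_cont_vertical (fun v => nat_cpow (S k) (- v) * kernel T M v)%C A y
      (Cder_cont _ _ _ (Cder_mult (fun v => nat_cpow (S k) (- v)%C) _ _ _ _ Hl Hm))). }
  set (v := fun k y => (a (S k) * nat_cpow (S k) (- s) * u k y)%C).
  assert (Hv : forall k, curve_cont_on (v k) (- T) T).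
  { intros k y Hy. apply curve_cont_scal. now apply Hu. }
  destruct (CInt_csum v (- T) T N ltac:(lra) Hv) as [Cv Ev].
  rewrite (csum_ext _ (fun k => CInt (v k) (- T) T)).
  2: { intros k. unfold v. rewrite CInt_scal by (try apply Hu; lra). fold (u k). ring. }
  rewrite <- Ev. unfold smooth_line. rewrite <- CInt_minus; [|lra| |exact Cv].
  2: apply smooth_integrand_cont; [assumption|lra].
  replace (2 * T) with (T - - T) by ring.
  apply Cmod_CInt_le_const; [lra| |].
  - apply curve_cont_on_minus; [|exact Cv]. apply smooth_integrand_cont; [assumption|lra].
  - intros y Hy.
    replace (csum (fun k => v k y) N)
      with (kernel T M (A, y) * csum (fun k => a (S k) * nat_cpow (S k) (- (s + (A, y)))) N)%C.
    2: { rewrite csum_scal. apply csum_ext. intros k. unfold v, u.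
         rewrite Copp_plus_distr, nat_cpow_plus. ring. }
    replace (f (s + (A, y)) * kernel T M (A, y)
       - kernel T M (A, y) * csum (fun k => a (S k) * nat_cpow (S k) (- (s + (A, y)))) N)%C
      with ((f (s + (A, y)) - csum (fun k => a (S k) * nat_cpow (S k) (- (s + (A, y)))) N)
        * kernel T M (A, y))%C by ring.
    rewrite Cmod_mult. apply Rmult_le_compat; try apply Cmod_ge_0.
    + apply H. unfold C_plus, half_plane in *. destruct s; simpl in *. lra.
    + apply kernel_crude; unfold T in *; lra.
Qed.

End Smoothing.

Lemma geometric_domination (q x K eps : R) : 0 <= q < x -> 0 < eps -> 0 <= K ->
  exists M0, forall M, (M0 <= M)%nat -> K * q ^ M <= eps * x ^ M.
Proof.
  intros Hq He HK.
  destruct (pow_lt_1_zero (q / x)) with (y := eps / (K + 1)) as [M0 H].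
  - rewrite Rabs_pos_eq by (apply Rdiv_le_0_compat; lra). apply Rlt_div_l; lra.
  - apply Rdiv_lt_0_compat; lra.
  - exists M0. intros M HM. specialize (H M HM).
    assert (Px : 0 < x ^ M) by (apply pow_lt; lra).
    assert (Pq : 0 <= q ^ M) by (apply pow_le; lra).
    assert (E : (q / x) ^ M = q ^ M / x ^ M).
    { unfold Rdiv. rewrite Rpow_mult_distr, pow_inv. reflexivity. }
    rewrite E, Rabs_pos_eq in H by (apply Rdiv_le_0_compat; lra).
    apply (proj1 (Rlt_div_l _ _ _ Px)) in H.
    apply Rle_trans with ((K + 1) * q ^ M); [nra|].
    apply Rle_trans with ((K + 1) * (eps / (K + 1) * x ^ M)).
    + apply Rmult_le_compat_l; lra.
    + apply Req_le. field. lra.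
Qed.

Lemma sup_norm_le_Cmod (f : C -> C) (s : C) : Rbar_le (sup_norm f) 1 -> C_plus s -> Cmod (f s) <= 1.
Proof.
  intros H Hs. unfold sup_norm in H.
  destruct (Lub_Rbar_correct (fun x => exists s, C_plus s /\ x = Cmod (f s))) as [U _].
  exact (Rbar_le_trans (Cmod (f s)) _ 1 (U (Cmod (f s)) (ex_intro _ s (conj Hs eq_refl))) H).
Qed.

Lemma H_infty_dirichlet_approx (f : C -> C) (s1 s2 : C) (eps : R) :
  H_infty f -> Rbar_le (sup_norm f) 1 -> C_plus s1 -> C_plus s2 -> 0 < eps ->
  exists T : list (C * nat), (forall p, In p T -> (1 <= snd p)%nat) /\
    (forall s, C_plus s -> Cmod (tsum T (fun n => nat_cpow n (- s)%C)) <= 1 + eps) /\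
    Cmod (tsum T (fun n => nat_cpow n (- s1)%C) - f s1)%C <= eps /\
    Cmod (tsum T (fun n => nat_cpow n (- s2)%C) - f s2)%C <= eps.
Proof.
  intros [Hana [_ [a [sigma [Hsig Hdir]]]]] Hnorm Hs1 Hs2 Heps.
  set (e := eps / 4). assert (He : 0 < e) by (unfold e; lra).
  assert (f_holo : forall s, C_plus s -> exists l, Cder f s l).
  { intros s Hs. destruct (Hana s Hs) as [l Hl]. exists l. now apply Cder_is_derive. }
  assert (f_le_1 : forall s, C_plus s -> Cmod (f s) <= 1).
  { intros s Hs. now apply sup_norm_le_Cmod. }
  (* On Re v = A the point s + v lies in the half-plane where the tail of the series is uniformly
     small. *)
  set (A := sigma + 3). assert (HA : 0 < A) by (unfold A; lra).
  set (T := 4 * A). assert (HT : 0 < T) by (unfold T; lra).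
  destruct (dirichlet_tail f a sigma Hdir) as [B [HB Htail]].
  assert (Hcont : exists eta, 0 < eta <= T /\
    (forall y, Rabs y < eta -> Cmod (f (s1 + (0, y)) - f s1)%C <= e) /\
    (forall y, Rabs y < eta -> Cmod (f (s2 + (0, y)) - f s2)%C <= e)).
  { destruct (f_holo s1 Hs1) as [l1 L1]. destruct (f_holo s2 Hs2) as [l2 L2].
    destruct (Cder_cont _ _ _ L1 e He) as [d1 [D1 E1]].
    destruct (Cder_cont _ _ _ L2 e He) as [d2 [D2 E2]].
    assert (Q : forall y, Cmod (0, y) <= Rabs y).
    { intros y. eapply Rle_trans; [apply Cmod_le_Re_Im|]. simpl. rewrite Rabs_R0. lra. }
    exists (Rmin T (Rmin d1 d2)). repeat split.
    - repeat apply Rmin_glb_lt; assumption.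
    - apply Rmin_l.
    - intros y Hy. apply Rlt_le, E1. eapply Rle_lt_trans; [apply Q|].
      eapply Rlt_le_trans; [exact Hy|]. eapply Rle_trans; [apply Rmin_r|apply Rmin_l].
    - intros y Hy. apply Rlt_le, E2. eapply Rle_lt_trans; [apply Q|].
      eapply Rlt_le_trans; [exact Hy|]. eapply Rle_trans; [apply Rmin_r|apply Rmin_r]. }
  destruct Hcont as [eta [Heta [Hc1 Hc2]]].
  (* The mass is at least eta X^M. The competing quantities decay like Y^M, away from 0, and
     (9/16)^M, on the horizontal sides; since eta <= T, X is at least 3/4 and beats both. *)
  set (X := 1 - (eta / 2) ^ 2 / T ^ 2). set (Y := 1 - eta ^ 2 / T ^ 2).
  assert (PT : 0 < T ^ 2) by (apply pow_lt; lra).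
  assert (Hr : 0 < eta ^ 2 / T ^ 2 <= 1).
  { split; [apply Rdiv_lt_0_compat; [apply pow_lt; lra|assumption]|]. apply Rle_div_l; nra. }
  assert (EX : X = 1 - eta ^ 2 / T ^ 2 / 4) by (unfold X; field; lra).
  assert (HY : 0 <= Y < X) by (rewrite EX; unfold Y; lra).
  assert (HQ : 0 <= 9 / 16 < X) by (rewrite EX; lra).
  destruct (geometric_domination Y X (2 * T * 2) (e * eta) HY ltac:(nra) ltac:(lra)) as [M1 HM1].
  destruct (geometric_domination (9 / 16) X (A * 2) (e * eta) HQ ltac:(nra) ltac:(lra)) as [M2 HM2].
  set (M := Nat.max M1 M2).
  specialize (HM1 M ltac:(lia)). specialize (HM2 M ltac:(lia)).
  set (m := kernel_mass T M).
  assert (Hm : eta * X ^ M <= m) by (apply kernel_mass_ge; assumption).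
  assert (PX : 0 < X ^ M) by (apply pow_lt; lra).
  assert (Pm : 0 < m) by nra.
  assert (P3 : 0 < 3 ^ M) by (apply pow_lt; lra).
  (* M and m are fixed by now, so N can be taken large enough to absorb the factor 3^M and the
     division by the mass m. *)
  destruct (nfloor_ex (2 * T * (B * 3 ^ M) / (e * m))) as [N0 HN0].
  { apply Rdiv_le_0_compat; [|nra]. apply Rmult_le_pos; [lra|]. apply Rmult_le_pos; lra. }
  set (N := S N0).
  assert (HN : 2 * T * (B / INR N * 3 ^ M) <= e * m).
  { assert (PN : 0 < INR N) by (apply lt_0_INR; unfold N; lia).
    replace (2 * T * (B / INR N * 3 ^ M)) with (2 * T * (B * 3 ^ M) / INR N) by (field; lra).
    apply Rle_div_l; [assumption|]. unfold N. rewrite S_INR.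
    destruct HN0 as [_ HN0]. assert (Hem : 0 < e * m) by nra.
    apply (proj1 (Rlt_div_l _ _ _ Hem)) in HN0. lra. }
  set (c := fun k => (RtoC (/ m) * (a (S k)
      * CInt (fun y => nat_cpow (S k) (- (A, y)) * kernel T M (A, y)) (- T) T))%C).
  exists (map (fun k => (c k, S k)) (seq 0 N)).
  assert (Em : forall s, tsum (map (fun k => (c k, S k)) (seq 0 N)) (fun n => nat_cpow n (- s)%C)
     = (RtoC (/ m) * csum (fun k => a (S k)
      * CInt (fun y => nat_cpow (S k) (- (A, y)) * kernel T M (A, y)) (- T) T
      * nat_cpow (S k) (- s)) N)%C).
  { intros s. rewrite <- csum_tsum, csum_scal. apply csum_ext. intros k. unfold c. ring. }
  (* The shift and the truncation each cost at most e m, hence 2e after division by m. [Main] serves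
     with w = 0, d = 1 for the bound on C_+, and with w = f(s1), w = f(s2), d = 2e for the
     approximation. *)
  assert (Main : forall s w, C_plus s -> forall d, Cmod (smooth_line f A M s 0 - RtoC m * w)%C <= d * m ->
    Cmod (tsum (map (fun k => (c k, S k)) (seq 0 N)) (fun n => nat_cpow n (- s)%C) - w)%C <= d + 2 * e).
  { intros s w Hs d Hd. rewrite Em.
    assert (B1 := smooth_shift f A M f_holo f_le_1 HA s Hs).
    assert (B2 := smooth_line_A_dirichlet f A M f_holo HA a (B / INR N) N s Hs
      ltac:(apply Rdiv_le_0_compat; [lra|apply lt_0_INR; unfold N; lia])
      ltac:(intros v Hv; apply Htail; [unfold N; lia|exact Hv])).
    fold T in B2.
    set (P := csum _ N) in *.
    replace (RtoC (/ m) * P - w)%C with (RtoC (/ m) * (P - RtoC m * w))%C.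
    2: { rewrite RtoC_inv by lra. field. intros Q. apply RtoC_inj in Q. lra. }
    rewrite Cmod_mult, Cmod_R, Rabs_pos_eq by now apply Rlt_le, Rinv_0_lt_compat.
    apply Rmult_le_reg_l with m; [assumption|]. rewrite <- Rmult_assoc, Rinv_r, Rmult_1_l by lra.
    replace (P - RtoC m * w)%C with
      (- (smooth_line f A M s A - P) + ((smooth_line f A M s A - smooth_line f A M s 0)
        + (smooth_line f A M s 0 - RtoC m * w)))%C by ring.
    eapply Rle_trans; [apply Cmod_triangle|].
    eapply Rle_trans; [apply Rplus_le_compat_l, Cmod_triangle|]. rewrite Cmod_opp.
    nra. }
  repeat split.
  - intros p Hp. apply in_map_iff in Hp. destruct Hp as [k [<- _]]. simpl. lia.
  - intros s Hs.
    assert (Q := Main s 0%C Hs 1).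
    assert (S0 := smooth_line_0_le f A M f_holo f_le_1 HA s Hs).
    replace (smooth_line f A M s 0 - RtoC m * 0)%C with (smooth_line f A M s 0) in Q by ring.
    fold T m in S0. specialize (Q ltac:(lra)).
    replace (tsum (map (fun k => (c k, S k)) (seq 0 N)) (fun n => nat_cpow n (- s)%C) - 0)%C
      with (tsum (map (fun k => (c k, S k)) (seq 0 N)) (fun n => nat_cpow n (- s)%C)) in Q by ring.
    unfold e in *. lra.
  - apply Rle_trans with (2 * e + 2 * e); [|unfold e; lra].
    apply Main; [assumption|].
    assert (Q := smooth_line_0_close f A M f_holo f_le_1 HA s1 e eta Hs1 He Heta Hc1).
    fold T m Y in Q. nra.
  - apply Rle_trans with (2 * e + 2 * e); [|unfold e; lra].
    apply Main; [assumption|].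
    assert (Q := smooth_line_0_close f A M f_holo f_le_1 HA s2 e eta Hs2 He Heta Hc2).
    fold T m Y in Q. nra.
Qed.

(** * Bohr's inequality *)

Definition vertical (t : R) (n : nat) : C := nat_cpow n (- (0, t))%C.

Lemma vertical_eq (t : R) (n : nat) : vertical t n = (cos (ln (INR n) * t), - sin (ln (INR n) * t)).
Proof.
  unfold vertical, nat_cpow, Cexp, Cmult, Copp, RtoC; simpl.
  replace (ln (INR n) * - 0 - 0 * - t) with 0 by ring.
  replace (ln (INR n) * - t + 0 * - 0) with (- (ln (INR n) * t)) by ring.
  rewrite exp_0, cos_neg, sin_neg. f_equal; ring.
Qed.

Definition completely_multiplicative (chi : nat -> C) : Prop :=
  chi 1%nat = 1%C /\
  forall m n, (1 <= m)%nat -> (1 <= n)%nat -> chi (m * n)%nat = (chi m * chi n)%C.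

Lemma vertical_completely_multiplicative (t : R) : completely_multiplicative (vertical t).
Proof.
  split; [apply nat_cpow_1|]. intros m n Hm Hn. now apply nat_cpow_mult.
Qed.

Definition l2sum (T : list (C * nat)) : R :=
  fold_right (fun p acc => Cmod (fst p) ^ 2 + acc) 0 T.

Lemma l2sum_ge_0 (T : list (C * nat)) : 0 <= l2sum T.
Proof.
  induction T as [|p T IH]; [apply Rle_refl|].
  change (0 <= Cmod (fst p) ^ 2 + l2sum T). assert (X := pow2_ge_0 (Cmod (fst p))). lra.
Qed.

(** For m <> n the product is a sinusoid of frequency u = log m - log n, which is not 0, and so has
    a bounded primitive. A bounded primitive expresses that its mean over long intervals is 0. *)
Lemma cross_term_primitive (c d : C) (m n : nat) : (1 <= m)%nat -> (1 <= n)%nat -> m <> n ->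
  exists (G : R -> R) (K : R), forall t,
    is_derive G t (Re (Cconj (c * vertical t n) * (d * vertical t m))%C) /\ Rabs (G t) <= K.
Proof.
  intros Hm Hn Hmn.
  set (u := ln (INR m) - ln (INR n)).
  assert (Hu : u <> 0).
  { intros E. apply Hmn, INR_eq, ln_inv.
    - now apply lt_0_INR.
    - now apply lt_0_INR.
    - unfold u in E. lra. }
  set (w := (Cconj c * d)%C).
  exists (fun t => (Re w * sin (u * t) - Im w * cos (u * t)) / u).
  exists ((Rabs (Re w) + Rabs (Im w)) / Rabs u).
  intros t. split.
  - replace (Re (Cconj (c * vertical t n) * (d * vertical t m))%C)
      with (Re w * cos (u * t) + Im w * sin (u * t)).
    + generalize (Re w) (Im w). intros x y. clearbody u. auto_derive; [trivial|]. field. assumption.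
    + replace (u * t) with (ln (INR m) * t - ln (INR n) * t) by (unfold u; ring).
      rewrite cos_minus, sin_minus, !vertical_eq. unfold w.
      destruct c as [c1 c2], d as [d1 d2]. simpl. ring.
  - unfold Rdiv. rewrite Rabs_mult, Rabs_inv.
    apply Rmult_le_compat_r; [apply Rlt_le, Rinv_0_lt_compat, Rabs_pos_lt, Hu|].
    eapply Rle_trans; [apply Rabs_triang|]. rewrite Rabs_Ropp, !Rabs_mult.
    apply Rplus_le_compat.
    + rewrite <- (Rmult_1_r (Rabs (Re w))) at 2. apply Rmult_le_compat_l; [apply Rabs_pos|].
      apply Rabs_le, SIN_bound.
    + rewrite <- (Rmult_1_r (Rabs (Im w))) at 2. apply Rmult_le_compat_l; [apply Rabs_pos|].
      apply Rabs_le, COS_bound.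
Qed.

Lemma cross_sum_primitive (c : C) (n : nat) (T : list (C * nat)) : (1 <= n)%nat ->
  (forall p, In p T -> (1 <= snd p)%nat) -> ~ In n (map snd T) ->
  exists (G : R -> R) (K : R), forall t,
    is_derive G t (Re (Cconj (c * vertical t n) * tsum T (vertical t))%C) /\ Rabs (G t) <= K.
Proof.
  intros Hn. induction T as [|[d m] T IH]; intros HT Hnot.
  - exists (fun _ => 0), 0. intros t. split; [|rewrite Rabs_R0; lra].
    simpl tsum. rewrite Cmult_0_r. apply (is_derive_const (V := R_NormedModule)).
  - destruct IH as [G1 [K1 H1]].
    + intros p Hp. apply HT. now right.
    + intros Q. apply Hnot. now right.
    + destruct (cross_term_primitive c d m n) as [G2 [K2 H2]].
      * apply (HT (d, m)). now left.
      * assumption.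
      * intros ->. apply Hnot. now left.
      * exists (fun t => G2 t + G1 t), (K2 + K1). intros t.
        destruct (H1 t) as [D1 B1]. destruct (H2 t) as [D2 B2]. split.
        -- simpl tsum. rewrite Cmult_plus_distr_l.
           exact (is_derive_plus (V := R_NormedModule) _ _ t _ _ D2 D1).
        -- eapply Rle_trans; [apply Rabs_triang|]. lra.
Qed.

(** The mean value theorem for Dirichlet polynomials in integrated form: the diagonal of |P(it)|^2
    contributes [t * l2sum T] to a primitive, the cross terms a bounded amount. Distinct frequencies
    are essential here. *)
Lemma square_primitive (T : list (C * nat)) :
  (forall p, In p T -> (1 <= snd p)%nat) -> NoDup (map snd T) ->
  exists (G : R -> R) (K : R), forall t,
    is_derive G t (Cmod (tsum T (vertical t)) ^ 2) /\ Rabs (G t - t * l2sum T) <= K.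
Proof.
  induction T as [|[c n] T IH]; intros HT HN.
  - exists (fun _ => 0), 0. intros t. simpl tsum; simpl l2sum. split.
    + rewrite Cmod_0. replace (0 ^ 2) with 0 by ring. apply (is_derive_const (V := R_NormedModule)).
    + replace (0 - t * 0) with 0 by ring. rewrite Rabs_R0; lra.
  - simpl in HN. apply NoDup_cons_iff in HN. destruct HN as [Hn HN].
    destruct IH as [G1 [K1 H1]]; [intros p Hp; apply HT; now right|assumption|].
    destruct (cross_sum_primitive c n T) as [G2 [K2 H2]].
    { apply (HT (c, n)). now left. } { intros p Hp; apply HT; now right. } { assumption. }
    exists (fun t => G1 t + 2 * G2 t + t * Cmod c ^ 2), (K1 + 2 * K2). intros t.
    destruct (H1 t) as [D1 B1]. destruct (H2 t) as [D2 B2]. split.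
    + replace (Cmod (tsum ((c, n) :: T) (vertical t)) ^ 2)
        with (Cmod (tsum T (vertical t)) ^ 2
          + 2 * Re (Cconj (c * vertical t n) * tsum T (vertical t))%C + 1 * Cmod c ^ 2).
      * apply (is_derive_plus (V := R_NormedModule) (fun t => G1 t + 2 * G2 t) (fun t => t * Cmod c ^ 2)).
        -- apply (is_derive_plus (V := R_NormedModule) G1 (fun t => 2 * G2 t)); [exact D1|].
           exact (is_derive_scal G2 t 2 _ D2).
        -- auto_derive; [trivial|]. ring.
      * simpl tsum. set (S := tsum T (vertical t)). rewrite !Cmod2_alt, vertical_eq.
        destruct c as [c1 c2], S as [x y]. simpl.
        assert (Q := sin2_cos2 (ln (INR n) * t)). unfold Rsqr in Q.
        set (s := sin (ln (INR n) * t)) in *. set (k := cos (ln (INR n) * t)) in *.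
        replace (1 * (c1 * (c1 * 1) + c2 * (c2 * 1)))
          with ((c1 * c1 + c2 * c2) * (s * s + k * k)) by (rewrite Q; ring). ring.
    + change (l2sum ((c, n) :: T)) with (Cmod c ^ 2 + l2sum T).
      replace (G1 t + 2 * G2 t + t * Cmod c ^ 2 - t * (Cmod c ^ 2 + l2sum T))
        with ((G1 t - t * l2sum T) + 2 * G2 t) by ring.
      eapply Rle_trans; [apply Rabs_triang|].
      rewrite Rabs_mult, (Rabs_pos_eq 2) by lra. lra.
Qed.

Lemma l2sum_le (T : list (C * nat)) (B : R) :
  (forall p, In p T -> (1 <= snd p)%nat) -> NoDup (map snd T) ->
  (forall t, Cmod (tsum T (vertical t)) <= B) -> l2sum T <= B ^ 2.
Proof.
  intros HT HN HB. destruct (square_primitive T HT HN) as [G [K H]].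
  apply Rnot_lt_le. intros L.
  assert (HK : 0 <= K) by (eapply Rle_trans; [apply Rabs_pos|apply (H 0)]).
  (* The primitive increases by at least [t * l2sum T - 2 * K] and by at most t B^2; this t makes
     the excess 2K + 1, beyond the error 2K. *)
  set (t := (2 * K + 1) / (l2sum T - B ^ 2)).
  assert (Ht : 0 < t) by (apply Rdiv_lt_0_compat; lra).
  destruct (MVT_gen G 0 t (fun t => Cmod (tsum T (vertical t)) ^ 2)) as [x [_ Hx]].
  - intros x _. apply H.
  - intros x _. apply continuity_pt_filterlim.
    apply (ex_derive_continuous (V := R_NormedModule)). eexists. apply H.
  - assert (Bx : Cmod (tsum T (vertical x)) ^ 2 <= B ^ 2).
    { apply pow_incr. split; [apply Cmod_ge_0|apply HB]. }
    destruct (H 0) as [_ B0]. destruct (H t) as [_ Bt].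
    apply Rabs_le_between in B0. apply Rabs_le_between in Bt.
    assert (Et : t * (l2sum T - B ^ 2) = 2 * K + 1) by (unfold t; field; lra).
    assert (Cmod (tsum T (vertical x)) ^ 2 * (t - 0) <= B ^ 2 * (t - 0))
      by (apply Rmult_le_compat_r; lra).
    nra.
Qed.

Lemma tsum_sqr_le (T : list (C * nat)) (chi : nat -> C) :
  (forall p, In p T -> Cmod (chi (snd p)) <= 1) ->
  Cmod (tsum T chi) ^ 2 <= INR (length T) * l2sum T.
Proof.
  induction T as [|[c n] T IH]; intros H.
  - simpl tsum. rewrite Cmod_0. simpl. lra.
  - specialize (IH (fun p Hp => H p (or_intror Hp))).
    assert (H1 := H (c, n) (or_introl eq_refl)). simpl in H1.
    change (length ((c, n) :: T)) with (S (length T)). rewrite S_INR.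
    change (l2sum ((c, n) :: T)) with (Cmod c ^ 2 + l2sum T). simpl tsum.
    set (N := INR (length T)) in *. assert (HN : 0 <= N) by apply pos_INR.
    set (S := tsum T chi) in *. set (Q := l2sum T) in *.
    assert (HQ : 0 <= Q) by apply l2sum_ge_0.
    assert (T0 : Cmod (c * chi n + S)%C <= Cmod c + Cmod S).
    { eapply Rle_trans; [apply Cmod_triangle|]. rewrite Cmod_mult.
      assert (X := Cmod_ge_0 c). assert (Y := Cmod_ge_0 (chi n)). nra. }
    apply Rle_trans with ((Cmod c + Cmod S) ^ 2).
    { apply pow_incr. split; [apply Cmod_ge_0|exact T0]. }
    assert (Hc := Cmod_ge_0 c). assert (HS := Cmod_ge_0 S).
    set (x := Cmod c) in *. set (s := Cmod S) in *.
    (* The arithmetic-geometric mean inequality for N x^2 and Q, with s^2 <= N Q from the induction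
       hypothesis. *)
    assert (X2 : 2 * x * s <= N * x ^ 2 + Q).
    { assert (Hx2 : 0 <= x ^ 2) by (apply pow2_ge_0).
      assert (HNx : 0 <= N * x ^ 2) by (apply Rmult_le_pos; assumption).
      apply Rsqr_incr_0_var; [|lra]. unfold Rsqr.
      assert (D := pow2_ge_0 (N * x ^ 2 - Q)).
      assert (I : x ^ 2 * s ^ 2 <= x ^ 2 * (N * Q)) by (apply Rmult_le_compat_l; assumption).
      replace (2 * x * s * (2 * x * s)) with (4 * (x ^ 2 * s ^ 2)) by ring.
      replace ((N * x ^ 2 + Q) * (N * x ^ 2 + Q))
        with ((N * x ^ 2 - Q) ^ 2 + 4 * (x ^ 2 * (N * Q))) by ring.
      lra. }
    replace ((x + s) ^ 2) with (x ^ 2 + 2 * x * s + s ^ 2) by ring. lra.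
Qed.

(** * Powers of Dirichlet polynomials and the number of their frequencies *)

Definition tmul (T U : list (C * nat)) : list (C * nat) :=
  flat_map (fun p => map (fun q => ((fst p * fst q)%C, (snd p * snd q)%nat)) U) T.

Fixpoint tpow (T : list (C * nat)) (k : nat) : list (C * nat) :=
  match k with O => (RtoC 1, 1%nat) :: nil | S k => tmul T (tpow T k) end.

Lemma in_tmul (T U : list (C * nat)) (r : C * nat) : In r (tmul T U) ->
  exists p q, In p T /\ In q U /\ snd r = (snd p * snd q)%nat.
Proof.
  intros H. apply in_flat_map in H. destruct H as [p [Hp H]].
  apply in_map_iff in H. destruct H as [q [<- Hq]]. exists p, q. auto.
Qed.

Lemma in_tpow_pos (T : list (C * nat)) (k : nat) : (forall p, In p T -> (1 <= snd p)%nat) ->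
  forall r, In r (tpow T k) -> (1 <= snd r)%nat.
Proof.
  intros HT. induction k as [|k IH]; intros r Hr.
  - destruct Hr as [<-|[]]. simpl. lia.
  - apply in_tmul in Hr. destruct Hr as [p [q [Hp [Hq ->]]]].
    specialize (HT p Hp). specialize (IH q Hq). nia.
Qed.

Lemma tsum_tmul (T U : list (C * nat)) (chi : nat -> C) : completely_multiplicative chi ->
  (forall p, In p T -> (1 <= snd p)%nat) -> (forall p, In p U -> (1 <= snd p)%nat) ->
  tsum (tmul T U) chi = (tsum T chi * tsum U chi)%C.
Proof.
  intros [_ Hm] HT HU. induction T as [|p T IH]; simpl; [ring|].
  rewrite tsum_app. fold (tmul T U). rewrite IH by (intros q Hq; apply HT; now right).
  rewrite Cmult_plus_distr_r. f_equal.
  assert (Hp := HT p (or_introl eq_refl)). clear IH HT.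
  induction U as [|q U IH]; simpl; [ring|].
  rewrite IH by (intros r Hr; apply HU; now right).
  rewrite Hm; [ring|assumption|]. apply HU. now left.
Qed.

Lemma tsum_tpow (T : list (C * nat)) (chi : nat -> C) (k : nat) : completely_multiplicative chi ->
  (forall p, In p T -> (1 <= snd p)%nat) -> tsum (tpow T k) chi = (tsum T chi ^ k)%C.
Proof.
  intros Hm HT. induction k as [|k IH].
  - simpl. destruct Hm as [-> _]. ring.
  - rewrite Cpow_S, <- IH. apply tsum_tmul; try assumption. now apply in_tpow_pos.
Qed.

(** The products of the entries of [ns] with each exponent at most k. This box of exponents contains
    all frequencies of a k-th power, and its size (k+1)^N, for N entries, is polynomial in k. *)
Fixpoint prods (ns : list nat) (k : nat) : list nat :=
  match ns with
  | nil => 1%nat :: nil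
  | n :: ns => flat_map (fun e => map (fun m => n ^ e * m)%nat (prods ns k)) (seq 0 (S k))
  end.

Lemma prods_length (ns : list nat) (k : nat) : length (prods ns k) = ((S k) ^ length ns)%nat.
Proof.
  induction ns as [|n ns IH]; [reflexivity|].
  cbn [prods length]. rewrite flat_map_concat_map, length_concat, map_map.
  rewrite (map_ext _ (fun _ => (S k) ^ length ns)%nat).
  - rewrite Nat.pow_succ_r'. generalize ((S k) ^ length ns)%nat as x. intros x.
    rewrite <- (length_seq (S k) 0) at 2. generalize (seq 0 (S k)) as l.
    induction l as [|y l IHl]; simpl; [reflexivity|]. rewrite IHl. reflexivity.
  - intros e. now rewrite length_map.
Qed.

Lemma prods_incr (ns : list nat) (k x : nat) : In x (prods ns k) -> In x (prods ns (S k)).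
Proof.
  revert x. induction ns as [|n ns IH]; intros x H; [exact H|].
  cbn [prods] in *. apply in_flat_map in H. destruct H as [e [He H]].
  apply in_map_iff in H. destruct H as [m [<- Hm]].
  apply in_flat_map. exists e. split; [apply in_seq in He; apply in_seq; lia|].
  apply in_map_iff. exists m. auto.
Qed.

Lemma prods_mul (ns : list nat) (k x n : nat) : In n ns -> In x (prods ns k) ->
  In (n * x)%nat (prods ns (S k)).
Proof.
  revert x. induction ns as [|m ns IH]; intros x Hn H; [destruct Hn|].
  cbn [prods] in *. apply in_flat_map in H. destruct H as [e [He H]].
  apply in_map_iff in H. destruct H as [y [<- Hy]]. apply in_seq in He.
  apply in_flat_map. destruct Hn as [->|Hn].
  - exists (S e). split; [apply in_seq; lia|].
    apply in_map_iff. exists y. split; [|now apply prods_incr].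
    rewrite Nat.pow_succ_r'. ring.
  - exists e. split; [apply in_seq; lia|].
    apply in_map_iff. exists (n * y)%nat. split; [ring|]. now apply IH.
Qed.

Lemma prods_1 (ns : list nat) (k : nat) : In 1%nat (prods ns k).
Proof.
  induction ns as [|m ns IH]; [now left|].
  cbn [prods]. apply in_flat_map. exists 0%nat. split; [apply in_seq; lia|].
  apply in_map_iff. exists 1%nat. split; [reflexivity|assumption].
Qed.

Lemma tpow_support (T : list (C * nat)) (k : nat) (r : C * nat) :
  In r (tpow T k) -> In (snd r) (prods (map snd T) k).
Proof.
  revert r. induction k as [|k IH]; intros r Hr.
  - destruct Hr as [<-|[]]. apply prods_1.
  - apply in_tmul in Hr. destruct Hr as [p [q [Hp [Hq ->]]]].
    apply prods_mul; [now apply in_map|now apply IH].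
Qed.

Fixpoint coef (T : list (C * nat)) (n : nat) : C :=
  match T with
  | nil => 0%C
  | p :: T => ((if Nat.eq_dec (snd p) n then fst p else 0) + coef T n)%C
  end.

(** Merges equal frequencies: [tpow] produces repetitions, whereas the bound on [l2sum] requires
    distinct frequencies. *)
Definition collect (T : list (C * nat)) (L : list nat) : list (C * nat) :=
  map (fun n => (coef T n, n)) L.

Lemma map_snd_collect (T : list (C * nat)) (L : list nat) : map snd (collect T L) = L.
Proof. unfold collect. rewrite map_map. apply map_id. Qed.

Lemma tsum_collect (T : list (C * nat)) (L : list nat) (chi : nat -> C) : NoDup L ->
  (forall p, In p T -> In (snd p) L) -> tsum (collect T L) chi = tsum T chi.
Proof.
  intros HL. induction T as [|[c n] T IH]; intros HT.
  - clear. induction L as [|n L IH]; simpl; [reflexivity|]. rewrite IH. simpl. ring.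
  - simpl tsum. rewrite <- IH by (intros p Hp; apply HT; now right).
    assert (Hn : In n L) by (apply (HT (c, n)); now left).
    clear IH HT. revert Hn. induction L as [|m L IH]; intros Hn; [destruct Hn|].
    apply NoDup_cons_iff in HL. destruct HL as [Hm HL]. simpl.
    destruct (Nat.eq_dec n m) as [->|E].
    + assert (X : tsum (collect ((c, m) :: T) L) chi = tsum (collect T L) chi).
      { clear - Hm. induction L as [|k L IH]; [reflexivity|]. simpl.
        rewrite IH by (intros Q; apply Hm; now right).
        destruct (Nat.eq_dec m k) as [->|E]; [exfalso; apply Hm; now left|]. ring. }
      unfold collect in *. simpl in *. rewrite X. ring.
    + destruct Hn as [->|Hn]; [congruence|]. specialize (IH HL Hn).
      unfold collect in *. simpl in *. rewrite IH. ring.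
Qed.

(** With r = sqrt q, split q^k as r^k r^k: by Bernoulli's inequality one factor absorbs one power of
    k+1, the other absorbs the rest by induction. *)
Lemma exp_dominates_pow (N : nat) : forall q, 1 < q ->
  exists K, 0 < K /\ forall k, INR (S k) ^ N <= K * q ^ k.
Proof.
  induction N as [|N IH]; intros q Hq.
  - exists 1. split; [lra|]. intros k. simpl. rewrite Rmult_1_l. apply pow_R1_Rle. lra.
  - set (r := sqrt q).
    assert (Hr : 1 < r) by (rewrite <- sqrt_1; apply sqrt_lt_1; lra).
    assert (Er : r * r = q) by (apply sqrt_sqrt; lra).
    destruct (IH r Hr) as [K [HK H]].
    set (K1 := 1 + / (r - 1)).
    assert (HK1 : 0 < / (r - 1)) by (apply Rinv_0_lt_compat; lra).
    exists (K1 * K). split; [unfold K1; nra|]. intros k.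
    assert (B : INR (S k) <= K1 * r ^ k).
    { assert (P := poly k (r - 1) ltac:(lra)). replace (1 + (r - 1)) with r in P by ring.
      assert (P1 : 1 <= r ^ k) by (apply pow_R1_Rle; lra).
      rewrite S_INR. unfold K1.
      assert (INR k = / (r - 1) * (INR k * (r - 1))) by (field; lra).
      assert (/ (r - 1) * (INR k * (r - 1)) <= / (r - 1) * r ^ k).
      { apply Rmult_le_compat_l; lra. }
      lra. }
    rewrite <- Er, Rpow_mult_distr. specialize (H k). cbn [pow].
    replace (K1 * K * (r ^ k * r ^ k)) with ((K1 * r ^ k) * (K * r ^ k)) by ring.
    apply Rmult_le_compat; try assumption; [apply pos_INR|apply pow_le, pos_INR].
Qed.

Lemma bounded_powers_le_1 (x K : R) : 0 <= x -> (forall k, x ^ k <= K) -> x <= 1.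
Proof.
  intros Hx H. apply Rnot_lt_le. intros L.
  destruct (nfloor_ex ((K + 1) / (x - 1))) as [n [_ Hn]].
  { apply Rdiv_le_0_compat; [|lra]. specialize (H 0%nat). simpl in H. lra. }
  assert (P := poly (S n) (x - 1) ltac:(lra)). replace (1 + (x - 1)) with x in P by ring.
  specialize (H (S n)). rewrite S_INR in P.
  apply (proj1 (Rlt_div_l _ _ _ (proj2 (Rlt_0_minus _ _) L))) in Hn. lra.
Qed.

(* The k-th power has at most (k+1)^N distinct frequencies, so Cauchy-Schwarz loses only a
   factor that disappears on taking k-th roots. *)
Theorem bohr_inequality (T : list (C * nat)) (B : R) (chi : nat -> C) :
  (forall p, In p T -> (1 <= snd p)%nat) -> 0 < B ->
  (forall t, Cmod (tsum T (vertical t)) <= B) ->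
  completely_multiplicative chi -> (forall n, (1 <= n)%nat -> Cmod (chi n) <= 1) ->
  Cmod (tsum T chi) <= B.
Proof.
  intros HT HB HTB Hchi Hchi1.
  set (Q := Cmod (tsum T chi)). assert (HQ : 0 <= Q) by apply Cmod_ge_0.
  set (N := length T).
  assert (Key : forall k, (Q ^ 2) ^ k <= INR (S k) ^ N * (B ^ 2) ^ k).
  { intros k. set (L := nodup Nat.eq_dec (prods (map snd T) k)).
    set (L' := filter (fun n => Nat.leb 1 n) L).
    assert (NL : NoDup L') by apply NoDup_filter, NoDup_nodup.
    assert (SL : forall p, In p (tpow T k) -> In (snd p) L').
    { intros p Hp. apply filter_In. split.
      - apply nodup_In. now apply tpow_support.
      - apply Nat.leb_le. eapply in_tpow_pos; eassumption. }
    set (U := collect (tpow T k) L').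
    assert (HU : forall p, In p U -> (1 <= snd p)%nat).
    { intros p Hp. apply (in_map snd) in Hp. unfold U in Hp. rewrite map_snd_collect in Hp.
      apply filter_In in Hp. apply Nat.leb_le, Hp. }
    assert (EU : forall psi, completely_multiplicative psi -> tsum U psi = (tsum T psi ^ k)%C).
    { intros psi Hpsi. unfold U. rewrite tsum_collect by assumption. now apply tsum_tpow. }
    assert (L2 : l2sum U <= (B ^ k) ^ 2).
    { apply l2sum_le; [assumption|unfold U; now rewrite map_snd_collect|].
      intros t. rewrite EU by apply vertical_completely_multiplicative.
      rewrite Cmod_pow. apply pow_incr. split; [apply Cmod_ge_0|apply HTB]. }
    assert (CS := tsum_sqr_le U chi (fun p Hp => Hchi1 _ (HU p Hp))).
    rewrite EU, Cmod_pow in CS by assumption. fold Q in CS.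
    rewrite <- !pow_mult, (Nat.mul_comm 2 k), !pow_mult.
    apply Rle_trans with (1 := CS).
    apply Rmult_le_compat; [apply pos_INR|apply l2sum_ge_0| |exact L2].
    rewrite <- pow_INR. apply le_INR. unfold U, collect. rewrite length_map.
    replace (S k ^ N)%nat with (length (prods (map snd T) k))
      by now rewrite prods_length, length_map.
    eapply Nat.le_trans; [apply filter_length_le|].
    apply NoDup_incl_length; [apply NoDup_nodup|]. intros x Hx. now apply nodup_In in Hx. }
  assert (B2 : 0 < B ^ 2) by (apply pow_lt; lra).
  (* The powers of Q^2/(q B^2) are bounded for every q > 1, because q^k outgrows (k+1)^N; a number
     with bounded powers is at most 1. This takes the place of the k-th roots. *)
  assert (Lim : forall q, 1 < q -> Q ^ 2 / (q * B ^ 2) <= 1).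
  { intros q Hq. destruct (exp_dominates_pow N q Hq) as [K [HK H]].
    assert (P0 : 0 < q * B ^ 2) by nra.
    apply bounded_powers_le_1 with K.
    - apply Rdiv_le_0_compat; [apply pow_le|]; assumption.
    - intros k. unfold Rdiv. rewrite Rpow_mult_distr, pow_inv.
      assert (P : 0 < (q * B ^ 2) ^ k) by now apply pow_lt.
      apply Rle_div_l; [assumption|]. rewrite Rpow_mult_distr.
      apply Rle_trans with (1 := Key k). rewrite <- Rmult_assoc.
      apply Rmult_le_compat_r; [apply Rlt_le, pow_lt; lra|apply H]. }
  apply Rnot_lt_le. intros L.
  assert (L2 : B ^ 2 < Q ^ 2) by nra.
  (* The midpoint between 1 and Q^2/B^2, so that q > 1 and still q B^2 < Q^2. *)
  set (q := (1 + Q ^ 2 / B ^ 2) / 2).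
  assert (Hq1 : 1 < Q ^ 2 / B ^ 2) by (apply Rlt_div_r; lra).
  specialize (Lim q ltac:(unfold q; lra)).
  assert (HqB : q * B ^ 2 = (B ^ 2 + Q ^ 2) / 2) by (unfold q; field; lra).
  rewrite HqB in Lim.
  assert (HP : 0 < (B ^ 2 + Q ^ 2) / 2) by lra.
  apply (proj1 (Rle_div_l _ _ _ HP)) in Lim. lra.
Qed.

(** * Valuations *)

(** [logn p n] is 0 when p is not prime. Products over all indices p < K below are therefore
    products over primes, the other factors being zeroth powers. *)
Definition valuation (p n : nat) : nat := mathcomp.boot.prime.logn p n.

Module ValuationFacts.
Import ssreflect ssrbool eqtype ssrnat seq div bigop prime.

Lemma valuation_mul (p m n : nat) : (1 <= m)%coq_nat -> (1 <= n)%coq_nat ->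
  valuation p (Nat.mul m n) = Nat.add (valuation p m) (valuation p n).
Proof. move=> /leP Hm /leP Hn. exact: lognM. Qed.

Lemma valuation_1 (p : nat) : valuation p 1 = 0%N.
Proof. exact: logn1. Qed.

Lemma prime_Z (p : nat) : prime p -> Znumtheory.prime (Z.of_nat p).
Proof.
move=> /primeP [/ltP H1 H2]. apply/prime_alt. split; first by lia.
move=> n Hn [q Hq].
have E : Nat.mul (Z.to_nat q) (Z.to_nat n) = p by nia.
have D : (Z.to_nat n %| p)%N by apply/dvdnP; exists (Z.to_nat q); rewrite -[LHS]E.
by case/orP: (H2 _ D) => /eqP; lia.
Qed.

Lemma valuation_prime (p n : nat) : valuation p n <> 0%N -> Znumtheory.prime (Z.of_nat p).
Proof.
move=> H. have : (0 < logn p n)%N by rewrite lt0n; apply/eqP.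
by rewrite logn_gt0 mem_primes => /and3P [/prime_Z].
Qed.

Lemma pow_expn (a b : nat) : Nat.pow a b = (a ^ b)%N.
Proof. by elim: b => //= b ->; rewrite expnS. Qed.

Lemma valuation_2_pow (k : nat) : valuation 2 (Nat.pow 2 k) = k.
Proof. by rewrite pow_expn /valuation pfactorK. Qed.

(** Runs over all p < K in the same recursion as [chi_prod], so that unique factorization can be
    transported factor by factor. *)
Fixpoint prime_power_prod (n K : nat) : nat :=
  match K with O => 1%N | S K => Nat.mul (prime_power_prod n K) (Nat.pow K (valuation K n)) end.

Lemma prime_power_prod_eq (n K : nat) : (1 <= n)%coq_nat -> (n < K)%coq_nat ->
  prime_power_prod n K = n.
Proof.
move=> /leP Hn; case: K => [|K] HK; first by lia.
have HnK : (n <= K)%N by apply/leP; lia.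
rewrite -[RHS](partnT Hn) (widen_partn _ HnK).
elim: K.+1 => [|k IH]; first by rewrite big_geq.
by rewrite big_nat_recr //= IH pow_expn.
Qed.

End ValuationFacts.

(** * Schwarz's lemma for uniform limits of polynomials *)

Fixpoint peval (l : list C) (x : C) : C :=
  match l with nil => 0%C | c :: l => (c + x * peval l x)%C end.

Fixpoint padd (l m : list C) : list C :=
  match l, m with
  | nil, _ => m
  | _, nil => l
  | c :: l, d :: m => (c + d)%C :: padd l m
  end.

Lemma peval_add (l m : list C) (x : C) : peval (padd l m) x = (peval l x + peval m x)%C.
Proof.
  revert m. induction l as [|c l IH]; intros [|d m]; simpl; try ring.
  rewrite IH. ring.
Qed.

Lemma peval_scal (c : C) (l : list C) (x : C) :
  peval (map (Cmult c) l) x = (c * peval l x)%C.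
Proof. induction l as [|d l IH]; simpl; [|rewrite IH]; ring. Qed.

Fixpoint pmul (l m : list C) : list C :=
  match l with
  | nil => nil
  | c :: l => padd (map (Cmult c) m) (RtoC 0 :: pmul l m)
  end.

Lemma peval_mul (l m : list C) (x : C) : peval (pmul l m) x = (peval l x * peval m x)%C.
Proof.
  induction l as [|c l IH]; cbn [pmul peval]; [ring|].
  rewrite peval_add, peval_scal. cbn [peval]. rewrite IH. ring.
Qed.

Lemma peval_bounded (l : list C) : exists K, 0 <= K /\ forall x, Cmod x <= 1 -> Cmod (peval l x) <= K.
Proof.
  induction l as [|c l [K [HK IH]]].
  - exists 0. split; [lra|]. intros x _. simpl. rewrite Cmod_0. lra.
  - exists (Cmod c + K). assert (Hc := Cmod_ge_0 c). split; [lra|].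
    intros x Hx. specialize (IH x Hx). simpl.
    eapply Rle_trans; [apply Cmod_triangle|]. rewrite Cmod_mult.
    assert (Hp := Cmod_ge_0 (peval l x)). assert (Hx0 := Cmod_ge_0 x). nra.
Qed.

(* Substituting [2^{-s}] for the variable turns a polynomial into a Dirichlet polynomial. *)
Fixpoint pterms (l : list C) (j : nat) : list (C * nat) :=
  match l with nil => nil | c :: l => (c, (2 ^ j)%nat) :: pterms l (S j) end.

Lemma pow2_pos (j : nat) : (1 <= 2 ^ j)%nat.
Proof. apply Nat.neq_0_lt_0, Nat.pow_nonzero. lia. Qed.

Lemma pterms_pos (l : list C) (j : nat) (p : C * nat) : In p (pterms l j) -> (1 <= snd p)%nat.
Proof.
  revert j. induction l as [|c l IH]; intros j H; [destruct H|].
  destruct H as [<-|H]; [apply pow2_pos|now apply (IH (S j))].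
Qed.

Lemma completely_multiplicative_pow (chi : nat -> C) (n j : nat) : completely_multiplicative chi ->
  (1 <= n)%nat -> chi (n ^ j)%nat = (chi n ^ j)%C.
Proof.
  intros [H1 Hm] Hn. induction j as [|j IH]; [exact H1|].
  rewrite Nat.pow_succ_r', Cpow_S, Hm, IH; [reflexivity|assumption|].
  apply Nat.neq_0_lt_0, Nat.pow_nonzero. lia.
Qed.

Lemma tsum_pterms (l : list C) (j : nat) (chi : nat -> C) : completely_multiplicative chi ->
  tsum (pterms l j) chi = (chi 2%nat ^ j * peval l (chi 2%nat))%C.
Proof.
  intros Hchi. revert j. induction l as [|c l IH]; intros j; simpl; [ring|].
  rewrite IH, completely_multiplicative_pow by (try assumption; lia). rewrite Cpow_S. ring.
Qed.

(** The function x^{v_2(n)} is completely multiplicative with value x at 2, while 2^{-it} lies on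
    the unit circle, where the bound is assumed. *)
Lemma poly_max_modulus (l : list C) (B : R) : 0 < B ->
  (forall u, Cmod u = 1 -> Cmod (peval l u) <= B) ->
  forall x, Cmod x <= 1 -> Cmod (peval l x) <= B.
Proof.
  intros HB H x Hx.
  set (chi := fun n => (x ^ valuation 2 n)%C).
  assert (Hchi : completely_multiplicative chi).
  { split; unfold chi.
    - now rewrite ValuationFacts.valuation_1.
    - intros m n Hm Hn. now rewrite ValuationFacts.valuation_mul, Cpow_add_r. }
  assert (E2 : chi 2%nat = x).
  { unfold chi. change 2%nat with (2 ^ 1)%nat at 2.
    now rewrite ValuationFacts.valuation_2_pow, Cpow_1_r. }
  replace (peval l x) with (tsum (pterms l 0) chi).
  2: { rewrite tsum_pterms, E2 by assumption. simpl. ring. }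
  apply bohr_inequality; try assumption.
  - intros p. apply pterms_pos.
  - intros t. rewrite tsum_pterms by apply vertical_completely_multiplicative.
    replace (vertical t 2 ^ 0 * peval l (vertical t 2))%C with (peval l (vertical t 2))
      by (simpl; ring).
    apply H. unfold vertical. rewrite Cmod_nat_cpow. simpl. rewrite Ropp_0, Rmult_0_r. apply exp_0.
  - intros n _. unfold chi. rewrite Cmod_pow.
    rewrite <- (pow1 (valuation 2 n)). apply pow_incr. split; [apply Cmod_ge_0|exact Hx].
Qed.

Definition disc_algebra (F : C -> C) : Prop :=
  forall eps, 0 < eps -> exists l, forall x, Cmod x <= 1 -> Cmod (F x - peval l x)%C <= eps.

(** Write an approximating polynomial as c + y q(y). On the unit circle |q(u)| = |u q(u)| is within
    e/2 of being at most M + |F(0)|; the maximum principle carries this bound on q to x, and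
    multiplication by x gives the claim up to e. *)
Lemma disc_algebra_schwarz (F : C -> C) (M : R) : 0 < M -> disc_algebra F ->
  (forall x, Cmod x <= 1 -> Cmod (F x) <= M) ->
  forall x, Cmod x <= 1 -> Cmod (F x - F 0)%C <= Cmod x * (M + Cmod (F 0%C)).
Proof.
  intros HM HF Hb x Hx. apply le_epsilon. intros e He.
  destruct (HF (e / 4)) as [l Hl]; [lra|].
  assert (H0 : Cmod 0 <= 1) by (rewrite Cmod_0; lra).
  assert (D : exists c q, forall y, peval l y = (c + y * peval q y)%C).
  { destruct l as [|c q]; [exists 0%C, nil; intros y; simpl; ring|].
    exists c, q. reflexivity. }
  destruct D as [c [q Hq]].
  assert (Ec : Cmod (F 0 - c)%C <= e / 4).
  { specialize (Hl 0%C H0). rewrite Hq in Hl.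
    replace (c + 0 * peval q 0)%C with c in Hl by ring. exact Hl. }
  assert (HF0 := Cmod_ge_0 (F 0%C)).
  assert (Bq : Cmod (peval q x) <= M + Cmod (F 0%C) + e / 2).
  { apply poly_max_modulus; [lra| |assumption]. intros u Hu.
    replace (Cmod (peval q u)) with (Cmod (u * peval q u)) by (rewrite Cmod_mult, Hu; ring).
    replace (u * peval q u)%C with (F u + - (F u - peval l u) + - F 0%C + (F 0%C - c))%C
      by (rewrite Hq; ring).
    eapply Rle_trans; [apply Cmod_triangle|].
    eapply Rle_trans; [apply Rplus_le_compat_r, Cmod_triangle|].
    eapply Rle_trans; [apply Rplus_le_compat_r, Rplus_le_compat_r, Cmod_triangle|].
    rewrite !Cmod_opp.
    specialize (Hl u ltac:(lra)). specialize (Hb u ltac:(lra)). lra. }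
  replace (F x - F 0)%C with ((F x - peval l x) + x * peval q x + - (F 0 - c))%C
    by (rewrite Hq; ring).
  eapply Rle_trans; [apply Cmod_triangle|].
  eapply Rle_trans; [apply Rplus_le_compat_r, Cmod_triangle|].
  rewrite Cmod_opp, Cmod_mult. specialize (Hl x Hx).
  assert (Hx0 := Cmod_ge_0 x).
  assert (Cmod x * Cmod (peval q x) <= Cmod x * (M + Cmod (F 0%C) + e / 2))
    by (apply Rmult_le_compat_l; assumption).
  nra.
Qed.

Lemma disc_algebra_ext (F G : C -> C) : (forall x, Cmod x <= 1 -> F x = G x) ->
  disc_algebra F -> disc_algebra G.
Proof.
  intros E H e He. destruct (H e He) as [l Hl]. exists l. intros x Hx. rewrite <- E by assumption. auto.
Qed.

Lemma disc_algebra_poly (l : list C) : disc_algebra (peval l).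
Proof.
  intros e He. exists l. intros x _.
  replace (peval l x - peval l x)%C with (RtoC 0) by ring. rewrite Cmod_0. lra.
Qed.

Lemma disc_algebra_const (c : C) : disc_algebra (fun _ => c).
Proof.
  apply (disc_algebra_ext (peval (c :: nil))); [|apply disc_algebra_poly].
  intros x _. simpl. ring.
Qed.

Lemma disc_algebra_affine (a b : C) : disc_algebra (fun x => a * x + b)%C.
Proof.
  apply (disc_algebra_ext (peval (b :: a :: nil))); [|apply disc_algebra_poly].
  intros x _. simpl. ring.
Qed.

Lemma disc_algebra_plus (F G : C -> C) : disc_algebra F -> disc_algebra G ->
  disc_algebra (fun x => F x + G x)%C.
Proof.
  intros HF HG e He. destruct (HF (e / 2)) as [l Hl]; [lra|]. destruct (HG (e / 2)) as [m Hm]; [lra|].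
  exists (padd l m). intros x Hx. rewrite peval_add.
  replace (F x + G x - (peval l x + peval m x))%C
    with ((F x - peval l x) + (G x - peval m x))%C by ring.
  eapply Rle_trans; [apply Cmod_triangle|]. specialize (Hl x Hx). specialize (Hm x Hx). lra.
Qed.

Lemma disc_algebra_bounded (F : C -> C) : disc_algebra F ->
  exists K, 0 <= K /\ forall x, Cmod x <= 1 -> Cmod (F x) <= K.
Proof.
  intros H. destruct (H 1 Rlt_0_1) as [l Hl]. destruct (peval_bounded l) as [K [HK Hp]].
  exists (1 + K). split; [lra|]. intros x Hx.
  replace (F x) with ((F x - peval l x) + peval l x)%C by ring.
  eapply Rle_trans; [apply Cmod_triangle|]. specialize (Hl x Hx). specialize (Hp x Hx). lra.
Qed.

Lemma disc_algebra_mult (F G : C -> C) : disc_algebra F -> disc_algebra G ->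
  disc_algebra (fun x => F x * G x)%C.
Proof.
  intros HF HG e He.
  destruct (disc_algebra_bounded G HG) as [K [HK BG]].
  destruct (HF (e / (2 * (K + 1)))) as [l Hl]; [apply Rdiv_lt_0_compat; lra|].
  destruct (peval_bounded l) as [L [HL BL]].
  destruct (HG (e / (2 * (L + 1)))) as [m Hm]; [apply Rdiv_lt_0_compat; lra|].
  exists (pmul l m). intros x Hx. rewrite peval_mul.
  replace (F x * G x - peval l x * peval m x)%C
    with ((F x - peval l x) * G x + peval l x * (G x - peval m x))%C by ring.
  eapply Rle_trans; [apply Cmod_triangle|]. rewrite !Cmod_mult.
  specialize (Hl x Hx). specialize (Hm x Hx). specialize (BG x Hx). specialize (BL x Hx).
  apply Rle_trans with (e / (2 * (K + 1)) * (K + 1) + (L + 1) * (e / (2 * (L + 1)))).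
  - apply Rplus_le_compat; apply Rmult_le_compat; try apply Cmod_ge_0; lra.
  - apply Req_le. field. lra.
Qed.

Lemma disc_algebra_pow (F : C -> C) (k : nat) : disc_algebra F -> disc_algebra (fun x => F x ^ k)%C.
Proof.
  intros HF. induction k as [|k IH]; [exact (disc_algebra_const 1%C)|].
  apply (disc_algebra_ext (fun x => F x * F x ^ k)%C); [|now apply disc_algebra_mult].
  intros x _. now rewrite Cpow_S.
Qed.

Lemma Cmod_1_plus_ge (b x : C) : Cmod x <= 1 -> 1 - Cmod b <= Cmod (1 + b * x)%C.
Proof.
  intros Hx. assert (T := Cmod_triangle (1 + b * x) (- (b * x))).
  replace (1 + b * x + - (b * x))%C with (RtoC 1) in T by ring.
  rewrite Cmod_1, Cmod_opp, Cmod_mult in T.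
  assert (Hb := Cmod_ge_0 b). assert (Hx0 := Cmod_ge_0 x). nra.
Qed.

Fixpoint geom (b : C) (n : nat) : list C :=
  match n with O => nil | S n => RtoC 1 :: map (Cmult (- b)%C) (geom b n) end.

(** Truncated geometric series: each further term multiplies the remainder by -b x, of modulus at
    most |b| on the closed disc. *)
Lemma disc_algebra_inv (b : C) : Cmod b < 1 -> disc_algebra (fun x => / (1 + b * x))%C.
Proof.
  intros Hb e He. assert (Hb0 := Cmod_ge_0 b).
  destruct (pow_lt_1_zero (Cmod b)) with (y := e * (1 - Cmod b)) as [n Hn].
  { rewrite Rabs_pos_eq; lra. } { apply Rmult_lt_0_compat; lra. }
  specialize (Hn n (le_n n)). rewrite Rabs_pos_eq in Hn by now apply pow_le.
  exists (geom b n). intros x Hx.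
  assert (Hlow := Cmod_1_plus_ge b x Hx).
  assert (Hne : (1 + b * x)%C <> 0%C) by (apply Cmod_gt_0; lra).
  assert (Hx0 := Cmod_ge_0 x).
  assert (Q : forall k, Cmod (/ (1 + b * x) - peval (geom b k) x)%C <= Cmod b ^ k * / (1 - Cmod b)).
  { induction k as [|k IH].
    - simpl. replace (/ (1 + b * x) - 0)%C with (/ (1 + b * x))%C by ring.
      rewrite Cmod_inv, Rmult_1_l by assumption. apply Rinv_le_contravar; lra.
    - cbn [geom peval]. rewrite peval_scal.
      replace (/ (1 + b * x) - (1 + x * (- b * peval (geom b k) x)))%C
        with (- (b * x) * (/ (1 + b * x) - peval (geom b k) x))%C by (field; assumption).
      rewrite Cmod_mult, Cmod_opp, Cmod_mult. simpl pow. rewrite Rmult_assoc.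
      rewrite Rmult_assoc. apply Rmult_le_compat_l; [assumption|].
      assert (P := Cmod_ge_0 (/ (1 + b * x) - peval (geom b k) x)%C). nra. }
  apply Rle_trans with (1 := Q n).
  apply Rle_div_l; lra.
Qed.

(** The completely multiplicative function with value z_p at the primes p < K and 1 at the larger
    primes. At non-prime indices z enters only through a zeroth power. *)
Fixpoint chi_prod (z : nat -> C) (K n : nat) : C :=
  match K with O => RtoC 1 | S K => (chi_prod z K n * z K ^ valuation K n)%C end.

Lemma chi_prod_completely_multiplicative (z : nat -> C) (K : nat) :
  completely_multiplicative (chi_prod z K).
Proof.
  induction K as [|K [IH1 IHm]]; (split; [|intros m n Hm Hn]); simpl.
  - reflexivity.
  - ring.
  - rewrite IH1, ValuationFacts.valuation_1. simpl. ring.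
  - rewrite IHm, ValuationFacts.valuation_mul, Cpow_add_r by assumption. ring.
Qed.

Lemma chi_prod_le_1 (z : nat -> C) (K n : nat) :
  (forall p, prime (Z.of_nat p) -> Cmod (z p) <= 1) -> Cmod (chi_prod z K n) <= 1.
Proof.
  intros Hz. induction K as [|K IH]; simpl; [rewrite Cmod_1; lra|].
  rewrite Cmod_mult, Cmod_pow.
  assert (P : 0 <= Cmod (z K) ^ valuation K n <= 1).
  { split; [apply pow_le, Cmod_ge_0|].
    destruct (Nat.eq_dec (valuation K n) 0) as [->|E]; [simpl; lra|].
    rewrite <- (pow1 (valuation K n)). apply pow_incr. split; [apply Cmod_ge_0|].
    apply Hz. now apply ValuationFacts.valuation_prime in E. }
  assert (Q := Cmod_ge_0 (chi_prod z K n)). nra.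
Qed.

Lemma chi_prod_nat_cpow (z : nat -> C) (K n : nat) (s : C) :
  (forall p, prime (Z.of_nat p) -> z p = nat_cpow p s) -> (1 <= n)%nat -> (n < K)%nat ->
  chi_prod z K n = nat_cpow n s.
Proof.
  intros Hz Hn HK. rewrite <- (ValuationFacts.prime_power_prod_eq n K Hn HK) at 2.
  clear HK Hn.
  assert (Q : (1 <= ValuationFacts.prime_power_prod n K)%nat /\
     chi_prod z K n = nat_cpow (ValuationFacts.prime_power_prod n K) s); [|apply Q].
  induction K as [|K [IH1 IH2]]; cbn [chi_prod ValuationFacts.prime_power_prod].
  - split; [lia|]. symmetry. apply nat_cpow_1.
  - rewrite IH2. destruct (Nat.eq_dec (valuation K n) 0) as [->|E].
    + rewrite Nat.pow_0_r, Nat.mul_1_r. split; [assumption|]. simpl. ring.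
    + apply ValuationFacts.valuation_prime in E. rewrite (Hz K E).
      assert (HK : (1 <= K)%nat) by (apply prime_ge_2 in E; lia).
      assert (HP : (1 <= K ^ valuation K n)%nat) by (apply Nat.neq_0_lt_0, Nat.pow_nonzero; lia).
      split; [nia|]. now rewrite nat_cpow_mult, nat_cpow_pow.
Qed.

Lemma disc_algebra_chi_prod (z : nat -> C -> C) (K n : nat) :
  (forall p, prime (Z.of_nat p) -> disc_algebra (z p)) ->
  disc_algebra (fun x => chi_prod (fun p => z p x) K n).
Proof.
  intros Hz. induction K as [|K IH]; simpl; [apply disc_algebra_const|].
  apply disc_algebra_mult; [assumption|].
  destruct (Nat.eq_dec (valuation K n) 0) as [->|E].
  - exact (disc_algebra_const 1%C).
  - apply disc_algebra_pow, Hz. now apply ValuationFacts.valuation_prime in E.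
Qed.

Lemma disc_algebra_tsum (T : list (C * nat)) (chi : C -> nat -> C) :
  (forall n, disc_algebra (fun x => chi x n)) -> disc_algebra (fun x => tsum T (chi x)).
Proof.
  intros H. induction T as [|[c n] T IH]; simpl; [apply disc_algebra_const|].
  apply disc_algebra_plus; [|assumption].
  apply disc_algebra_mult; [apply disc_algebra_const|apply H].
Qed.

(** * The upper bound *)

Lemma Cder_tsum (T : list (C * nat)) (z : C) :
  exists l, Cder (fun s => tsum T (fun n => nat_cpow n (- s)%C)) z l.
Proof.
  induction T as [|[c n] T [l IH]].
  - exists 0%C. exact (Cder_const 0%C z).
  - destruct (Cder_nat_cpow_opp n z) as [m Hm]. eexists.
    exact (Cder_plus _ _ _ _ _ (Cder_mult (fun _ => c) _ _ _ _ (Cder_const c z) Hm) IH).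
Qed.

(** Continuity at it, approached along the points it + d/2 of C_+. *)
Lemma tsum_boundary_le (T : list (C * nat)) (B : R) :
  (forall s, C_plus s -> Cmod (tsum T (fun n => nat_cpow n (- s)%C)) <= B) ->
  forall t, Cmod (tsum T (vertical t)) <= B.
Proof.
  intros H t. apply le_epsilon. intros e He.
  destruct (Cder_tsum T (0, t)) as [l Hl].
  destruct (Cder_cont _ _ _ Hl e He) as [d [Hd Hc]].
  specialize (Hc (RtoC (d / 2))). rewrite Cmod_R, Rabs_pos_eq in Hc by lra.
  specialize (Hc ltac:(lra)).
  specialize (H ((0, t) + RtoC (d / 2))%C). specialize (H ltac:(unfold C_plus, half_plane; simpl; lra)).
  change (tsum T (fun n => nat_cpow n (- (0, t))%C)) with (tsum T (vertical t)) in Hc.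
  set (P := tsum T (fun n => nat_cpow n (- ((0, t) + RtoC (d / 2)))%C)) in *.
  replace (tsum T (vertical t)) with (P + - (P - tsum T (vertical t)))%C by ring.
  eapply Rle_trans; [apply Cmod_triangle|]. rewrite Cmod_opp. lra.
Qed.

Lemma Cmod_one_minus_conj (a x : C) : Cmod a < 1 -> Cmod x <= 1 -> (1 - Cconj a * x)%C <> 0%C.
Proof.
  intros Ha Hx E. assert (T := Cmod_1_plus_ge (- Cconj a) x Hx).
  replace (1 + - Cconj a * x)%C with (1 - Cconj a * x)%C in T by ring.
  rewrite E, Cmod_0, Cmod_opp, Cmod_conj in T. lra.
Qed.

(** For a and w in the disc the right-hand side is nonnegative, which is why (w + a)/(1 + conj(a) w)
    stays in the disc. *)
Lemma moebius_identity (a w : C) :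
  Cmod (1 + Cconj a * w)%C ^ 2 - Cmod (w + a)%C ^ 2 = (1 - Cmod a ^ 2) * (1 - Cmod w ^ 2).
Proof. rewrite !Cmod2_alt. destruct a, w. simpl. ring. Qed.

Lemma moebius_le_1 (a w : C) : Cmod a < 1 -> Cmod w <= 1 ->
  Cmod ((w + a) / (1 + Cconj a * w))%C <= 1.
Proof.
  intros Ha Hw. assert (L := Cmod_1_plus_ge (Cconj a) w Hw). rewrite Cmod_conj in L.
  assert (Hne : (1 + Cconj a * w)%C <> 0%C) by (apply Cmod_gt_0; lra).
  rewrite Cmod_div by assumption. apply Rle_div_l; [lra|]. rewrite Rmult_1_l.
  assert (I := moebius_identity a w). assert (Ha0 := Cmod_ge_0 a). assert (Hw0 := Cmod_ge_0 w).
  assert (0 <= (1 - Cmod a ^ 2) * (1 - Cmod w ^ 2)) by (apply Rmult_le_pos; nra).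
  apply Rsqr_incr_0_var; [|lra]. unfold Rsqr. nra.
Qed.

Lemma disc_algebra_moebius (a c : C) : Cmod a < 1 -> Cmod c <= 1 ->
  disc_algebra (fun x => (c * x + a) / (1 + Cconj a * (c * x)))%C.
Proof.
  intros Ha Hc. apply disc_algebra_mult; [apply disc_algebra_affine|].
  apply (disc_algebra_ext (fun x => / (1 + (Cconj a * c) * x))%C).
  - intros x _. f_equal. ring.
  - apply disc_algebra_inv. rewrite Cmod_mult, Cmod_conj.
    assert (H1 := Cmod_ge_0 a). assert (H2 := Cmod_ge_0 c). nra.
Qed.

(** [rho_disc] conjugates its first argument, the Moebius map vanishing at a conjugates a; the two
    denominators are complex conjugates of each other. *)
Lemma rho_disc_alt (x a : C) : Cmod a < 1 -> Cmod x <= 1 ->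
  Cmod ((x - a) / (1 - Cconj a * x))%C = rho_disc x a.
Proof.
  intros Ha Hx. unfold rho_disc.
  assert (H1 := Cmod_one_minus_conj a x Ha Hx).
  assert (E : (1 - Cconj x * a)%C = Cconj (1 - Cconj a * x)%C).
  { rewrite Cminus_conj, Cmult_conj, Cconj_conj. replace (Cconj 1) with (RtoC 1).
    - ring.
    - unfold Cconj, RtoC; simpl. f_equal. ring. }
  assert (M : Cmod (1 - Cconj x * a)%C = Cmod (1 - Cconj a * x)%C) by (rewrite E; apply Cmod_conj).
  rewrite !Cmod_div, M; try assumption; [reflexivity|].
  apply Cmod_gt_0. rewrite M. now apply Cmod_gt_0.
Qed.

(* The points (p^{-s2})_p and (p^{-s1})_p of the polydisc lie on the analytic disc whose p-th
   coordinate is the disc automorphism z_p below, at the parameters 0 and r. *)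
Lemma dirichlet_polynomial_schwarz (T : list (C * nat)) (B r : R) (s1 s2 : C) :
  (forall p, In p T -> (1 <= snd p)%nat) -> 0 < B ->
  (forall s, C_plus s -> Cmod (tsum T (fun n => nat_cpow n (- s)%C)) <= B) ->
  C_plus s1 -> C_plus s2 -> 0 < r <= 1 ->
  (forall p, prime (Z.of_nat p) -> rho_disc (nat_cpow p (- s1)%C) (nat_cpow p (- s2)%C) <= r) ->
  Cmod (tsum T (fun n => nat_cpow n (- s1)) - tsum T (fun n => nat_cpow n (- s2)))%C
   <= r * (B + Cmod (tsum T (fun n => nat_cpow n (- s2)%C))).
Proof.
  intros HT HB Hbd Hs1 Hs2 Hr Hrho.
  set (a := fun p => nat_cpow p (- s2)%C). set (x := fun p => nat_cpow p (- s1)%C).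
  (* For p prime, the automorphism sending a_p to 0 takes x_p to a point of modulus rho_D(x_p, a_p)
     <= r, so c_p lies in the closed disc. The map z_p is multiplication by c_p followed by the
     inverse automorphism; it sends 0 to a_p and r to x_p. *)
  set (c := fun p => ((x p - a p) / (1 - Cconj (a p) * x p) / RtoC r)%C).
  set (z := fun p y => ((c p * y + a p) / (1 + Cconj (a p) * (c p * y)))%C).
  assert (Er : RtoC r <> 0%C) by (intros E; apply RtoC_inj in E; lra).
  assert (Hp2 : forall p, prime (Z.of_nat p) -> (2 <= p)%nat).
  { intros p Hp. apply prime_ge_2 in Hp. lia. }
  assert (Ha : forall p, prime (Z.of_nat p) -> Cmod (a p) < 1).
  { intros p Hp. apply Cmod_nat_cpow_lt_1; [now apply Hp2|exact Hs2]. }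
  assert (Hx : forall p, prime (Z.of_nat p) -> Cmod (x p) < 1).
  { intros p Hp. apply Cmod_nat_cpow_lt_1; [now apply Hp2|exact Hs1]. }
  assert (Hc : forall p, prime (Z.of_nat p) -> Cmod (c p) <= 1).
  { intros p Hp. unfold c. rewrite Cmod_div, Cmod_R, (Rabs_pos_eq r) by (try assumption; lra).
    specialize (Ha p Hp). specialize (Hx p Hp).
    rewrite rho_disc_alt by lra. apply Rle_div_l; [lra|]. rewrite Rmult_1_l. now apply Hrho. }
  assert (Hz1 : forall y p, Cmod y <= 1 -> prime (Z.of_nat p) -> Cmod (z p y) <= 1).
  { intros y p Hy Hp. apply moebius_le_1; [now apply Ha|]. rewrite Cmod_mult.
    specialize (Hc p Hp). assert (H1 := Cmod_ge_0 y). assert (H2 := Cmod_ge_0 (c p)). nra. }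
  assert (Hz0 : forall p, z p 0%C = a p).
  { intros p. unfold z. replace (1 + Cconj (a p) * (c p * 0))%C with (RtoC 1) by ring.
    field. }
  assert (Hzr : forall p, prime (Z.of_nat p) -> z p (RtoC r) = x p).
  { intros p Hp. specialize (Ha p Hp). specialize (Hx p Hp).
    assert (D1 := Cmod_one_minus_conj (a p) (x p) Ha ltac:(lra)).
    assert (D2 := Cmod_one_minus_conj (a p) (a p) Ha ltac:(lra)).
    unfold z. replace (c p * RtoC r)%C with ((x p - a p) / (1 - Cconj (a p) * x p))%C
      by (unfold c; field; auto).
    field. split; [assumption|].
    replace (1 - Cconj (a p) * x p + Cconj (a p) * (x p - a p))%C
      with (1 - Cconj (a p) * a p)%C by ring. assumption. }
  (* K exceeds every frequency of T, so the primes below K suffice to factor all of them. *)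
  set (K := S (list_max (map snd T))).
  assert (HK : forall p, In p T -> (snd p < K)%nat).
  { intros p Hp. unfold K. apply Nat.lt_succ_r.
    assert (F := proj1 (list_max_le (map snd T) _) (le_n _)).
    rewrite Forall_forall in F. apply F. now apply in_map. }
  set (F := fun y => tsum T (chi_prod (fun p => z p y) K)).
  assert (HF : disc_algebra F).
  { apply disc_algebra_tsum. intros n. apply disc_algebra_chi_prod.
    intros p Hp. apply disc_algebra_moebius; [now apply Ha|now apply Hc]. }
  assert (HFB : forall y, Cmod y <= 1 -> Cmod (F y) <= B).
  { intros y Hy. apply bohr_inequality; try assumption.
    - now apply tsum_boundary_le.
    - apply chi_prod_completely_multiplicative.
    - intros n _. apply chi_prod_le_1. intros p Hp. now apply Hz1. }
  assert (Ext : forall chi psi : nat -> C, (forall n, (1 <= n)%nat -> (n < K)%nat -> chi n = psi n) ->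
     tsum T chi = tsum T psi).
  { intros chi psi E. clear - E HT HK. clearbody K. induction T as [|p T' IH]; [reflexivity|]. simpl.
    rewrite IH; try (intros q Hq; (apply HT || apply HK); now right).
    rewrite E; [reflexivity|apply HT|apply HK]; now left. }
  assert (F0 : F 0%C = tsum T (fun n => nat_cpow n (- s2)%C)).
  { apply Ext. intros n H1 H2. apply chi_prod_nat_cpow; try assumption. intros p _. apply Hz0. }
  assert (Fr : F (RtoC r) = tsum T (fun n => nat_cpow n (- s1)%C)).
  { apply Ext. intros n H1 H2. apply chi_prod_nat_cpow; assumption. }
  assert (Mr : Cmod (RtoC r) = r) by (rewrite Cmod_R; apply Rabs_pos_eq; lra).
  assert (S := disc_algebra_schwarz F B HB HF HFB (RtoC r) ltac:(lra)).
  rewrite Mr, F0, Fr in S. exact S.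
Qed.

Lemma H_infty_le_of_rho_le (f : C -> C) (s1 s2 : C) (r : R) :
  H_infty f -> Rbar_le (sup_norm f) 1 -> f s2 = 0%C -> C_plus s1 -> C_plus s2 -> 0 < r ->
  (forall p, prime (Z.of_nat p) -> rho_disc (nat_cpow p (- s1)%C) (nat_cpow p (- s2)%C) <= r) ->
  Cmod (f s1) <= r.
Proof.
  intros Hf Hn H0 Hs1 Hs2 Hr Hrho.
  (* For r >= 1 the norm bound suffices; otherwise r is a point of the disc at which Schwarz's lemma
     applies. *)
  destruct (Rle_dec 1 r) as [L|L].
  { eapply Rle_trans; [apply sup_norm_le_Cmod; eassumption|exact L]. }
  apply Rnot_le_lt in L.
  apply le_epsilon. intros e He.
  (* The losses are e/4 for P1 - f(s1), at most r (e/4 + e/4) in Schwarz's lemma and e/4 for P2;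
     with r < 1 they sum to at most e. *)
  destruct (H_infty_dirichlet_approx f s1 s2 (e / 4) Hf Hn Hs1 Hs2 ltac:(lra))
    as [T [HT [HB [E1 E2]]]].
  assert (S := dirichlet_polynomial_schwarz T (1 + e / 4) r s1 s2 HT ltac:(lra) HB Hs1 Hs2
    ltac:(lra) Hrho).
  set (P1 := tsum T (fun n => nat_cpow n (- s1)%C)) in *.
  set (P2 := tsum T (fun n => nat_cpow n (- s2)%C)) in *.
  rewrite H0 in E2. replace (P2 - 0)%C with P2 in E2 by ring.
  replace (f s1) with (- (P1 - f s1) + ((P1 - P2) + P2))%C by ring.
  eapply Rle_trans; [apply Cmod_triangle|].
  eapply Rle_trans; [apply Rplus_le_compat_l, Cmod_triangle|]. rewrite Cmod_opp.
  assert (Hp2 := Cmod_ge_0 P2). nra.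
Qed.

(** * The lower bound *)

Section PrimeFactor.

Variables (p : nat) (a : C).
Hypothesis p_ge_2 : (2 <= p)%nat.
Hypothesis a_lt_1 : Cmod a < 1.

Definition moebius (x : C) : C := ((x - a) / (1 - Cconj a * x))%C.

(** The Taylor coefficients at 0 of (x - a)/(1 - conj(a) x): -a, then (1 - |a|^2) conj(a)^{k-1} for
    k >= 1. *)
Definition moebius_coef (k : nat) : C :=
  match k with O => (- a)%C | S k => ((1 - a * Cconj a) * Cconj a ^ k)%C end.

Lemma moebius_remainder (x : C) (k : nat) : Cmod x <= 1 ->
  (moebius x - csum (fun j => moebius_coef j * x ^ j) (S k))%C
    = ((1 - a * Cconj a) * Cconj a ^ k * x ^ S k / (1 - Cconj a * x))%C.
Proof.
  intros Hx. assert (D := Cmod_one_minus_conj a x a_lt_1 Hx).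
  induction k as [|k IH].
  - simpl. unfold moebius. field. assumption.
  - replace (csum (fun j => moebius_coef j * x ^ j) (S (S k)))%C
      with (csum (fun j => moebius_coef j * x ^ j) (S k) + moebius_coef (S k) * x ^ S k)%C by reflexivity.
    transitivity ((moebius x - csum (fun j => moebius_coef j * x ^ j) (S k))
      - moebius_coef (S k) * x ^ S k)%C; [ring|].
    rewrite IH. unfold moebius_coef. rewrite !Cpow_S. field. assumption.
Qed.

Lemma moebius_series_cv (x : C) : Cmod x < 1 -> forall eps, 0 < eps ->
  exists k0, forall k, (k0 <= k)%nat ->
    Cmod (csum (fun j => moebius_coef j * x ^ j) (S k) - moebius x)%C < eps.
Proof.
  intros Hx eps He. assert (Ha := Cmod_ge_0 a). assert (Hx0 := Cmod_ge_0 x).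
  destruct (pow_lt_1_zero (Cmod x)) with (y := eps * (1 - Cmod a) / 2) as [k0 Hk0].
  { rewrite Rabs_pos_eq; lra. }
  { apply Rdiv_lt_0_compat; [apply Rmult_lt_0_compat; lra|lra]. }
  exists k0. intros k Hk. specialize (Hk0 (S k) ltac:(lia)).
  rewrite Rabs_pos_eq in Hk0 by now apply pow_le.
  rewrite <- Cmod_opp.
  replace (- (csum (fun j => moebius_coef j * x ^ j) (S k) - moebius x))%C
    with (moebius x - csum (fun j => moebius_coef j * x ^ j) (S k))%C by ring.
  rewrite moebius_remainder by lra.
  assert (D := Cmod_one_minus_conj a x a_lt_1 ltac:(lra)).
  rewrite Cmod_div by assumption. rewrite !Cmod_mult, !Cmod_pow, Cmod_conj.
  assert (L := Cmod_1_plus_ge (- Cconj a) x ltac:(lra)).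
  replace (1 + - Cconj a * x)%C with (1 - Cconj a * x)%C in L by ring.
  rewrite Cmod_opp, Cmod_conj in L.
  assert (N : Cmod (1 - a * Cconj a)%C <= 2).
  { eapply Rle_trans; [apply Cmod_triangle|]. rewrite Cmod_1, Cmod_opp, Cmod_mult, Cmod_conj. nra. }
  assert (Pa : 0 <= Cmod a ^ k <= 1).
  { split; [now apply pow_le|]. rewrite <- (pow1 k). apply pow_incr. lra. }
  assert (Px : 0 <= Cmod x ^ S k) by now apply pow_le.
  apply Rlt_div_l; [lra|].
  assert (N0 := Cmod_ge_0 (1 - a * Cconj a)%C).
  apply Rle_lt_trans with (2 * Cmod x ^ S k).
  - apply Rmult_le_compat_r; [assumption|]. nra.
  - apply Rlt_le_trans with (eps * (1 - Cmod a)); [lra|]. apply Rmult_le_compat_l; lra.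
Qed.

(** The coefficient of n^{-s} once x is replaced by p^{-s}. The range k < n contains every exponent
    with p^k = n, because k < p^k. *)
Definition moebius_dirichlet_coef (n : nat) : C :=
  csum (fun k => if Nat.eq_dec (p ^ k) n then moebius_coef k else 0%C) n.

Lemma moebius_dirichlet_coef_pow (k : nat) : moebius_dirichlet_coef (p ^ k) = moebius_coef k.
Proof.
  unfold moebius_dirichlet_coef.
  assert (Q : forall N, csum (fun j => if Nat.eq_dec (p ^ j) (p ^ k) then moebius_coef j else 0%C) N
     = if Nat.ltb k N then moebius_coef k else 0%C).
  { induction N as [|N IH]; [reflexivity|]. simpl csum. rewrite IH.
    destruct (Nat.eq_dec (p ^ N) (p ^ k)) as [E|E].
    - apply Nat.pow_inj_r in E; [subst N|lia].
      rewrite (proj2 (Nat.ltb_ge k k)), (proj2 (Nat.ltb_lt k (S k))) by lia. ring.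
    - assert (k <> N) by (intros ->; now apply E).
      destruct (Nat.ltb_spec k N), (Nat.ltb_spec k (S N)); try lia; ring. }
  rewrite Q, (proj2 (Nat.ltb_lt _ _)); [reflexivity|]. apply Nat.pow_gt_lin_r. lia.
Qed.

Lemma moebius_dirichlet_coef_0 (n : nat) : (forall k, (p ^ k)%nat <> n) ->
  moebius_dirichlet_coef n = 0%C.
Proof.
  intros H.
  assert (Q : forall N, csum (fun k => if Nat.eq_dec (p ^ k) n then moebius_coef k else 0%C) N = 0%C).
  { induction N as [|N IH]; [reflexivity|]. simpl. rewrite IH.
    destruct (Nat.eq_dec (p ^ N) n) as [E|E]; [now apply H in E|]. ring. }
  apply Q.
Qed.

(** The partial sums of the Dirichlet series change only at powers of p, so they run through the
    partial sums of the power series in p^{-s}; convergence is thus inherited from the latter. *)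
Lemma moebius_dirichlet_partial_sum (s : C) (m : nat) : (1 <= m)%nat ->
  exists k, (p ^ k <= m < p ^ S k)%nat /\
    csum (fun i => moebius_dirichlet_coef (S i) * nat_cpow (S i) (- s))%C m
      = csum (fun j => moebius_coef j * nat_cpow p (- s) ^ j)%C (S k).
Proof.
  intros Hm. induction Hm as [|m Hm [k [Hk E]]].
  - exists 0%nat. split; [simpl; lia|]. simpl.
    rewrite nat_cpow_1. change 1%nat with (p ^ 0)%nat at 1.
    rewrite moebius_dirichlet_coef_pow. simpl. ring.
  - cbn [csum] in E |- *. rewrite E.
    destruct (Nat.eq_dec (S m) (p ^ S k)) as [Q|Q].
    + exists (S k). split.
      * rewrite Q. split; [lia|]. apply Nat.pow_lt_mono_r; lia.
      * cbn [csum]. rewrite Q, moebius_dirichlet_coef_pow, nat_cpow_pow by lia. reflexivity.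
    + exists k. split; [lia|].
      rewrite moebius_dirichlet_coef_0; [cbn [csum]; ring|].
      intros j Hj.
      destruct (Nat.le_gt_cases j k) as [L|L].
      * assert (p ^ j <= p ^ k)%nat by (apply Nat.pow_le_mono_r; lia). lia.
      * assert (p ^ S k <= p ^ j)%nat by (apply Nat.pow_le_mono_r; lia). lia.
Qed.

Lemma moebius_H_infty :
  H_infty (fun s => moebius (nat_cpow p (- s))) /\
  Rbar_le (sup_norm (fun s => moebius (nat_cpow p (- s)))) 1.
Proof.
  assert (Hx : forall s, C_plus s -> Cmod (nat_cpow p (- s)%C) < 1).
  { intros s Hs. now apply Cmod_nat_cpow_lt_1. }
  assert (Hb : forall s, C_plus s -> Cmod (moebius (nat_cpow p (- s)%C)) <= 1).
  { intros s Hs. unfold moebius. specialize (Hx s Hs).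
    replace (1 - Cconj a * nat_cpow p (- s))%C with (1 + Cconj (- a) * nat_cpow p (- s))%C
      by (rewrite Copp_conj; ring).
    apply moebius_le_1; [rewrite Cmod_opp; assumption|lra]. }
  split; [split; [|split]|].
  - intros s Hs. destruct (Cder_nat_cpow_opp p s) as [l Hl].
    eexists. apply Cder_is_derive.
    apply (Cder_comp moebius (fun s => nat_cpow p (- s)%C)); [exact Hl|].
    apply (Cder_mult (fun x => x - a)%C (fun x => / (1 - Cconj a * x))%C).
    + apply (Cder_ext (fun x => 1 * x + - a)%C); [intros w; ring|apply Cder_lin].
    + apply (Cder_comp (fun y => / y)%C (fun x => 1 - Cconj a * x)%C).
      * apply (Cder_ext (fun x => (- Cconj a) * x + 1)%C); [intros w; ring|apply Cder_lin].
      * apply Cder_inv. apply Cmod_one_minus_conj; [assumption|]. apply Rlt_le, Hx, Hs.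
  - exists 1. exact Hb.
  - exists moebius_dirichlet_coef, 0. split; [lra|]. intros s Hs.
    unfold dirichlet_sum. apply is_series_csum. intros eps He.
    destruct (moebius_series_cv (nat_cpow p (- s)%C) (Hx s Hs) eps He) as [k0 H0].
    exists (p ^ k0)%nat. intros m Hm.
    assert (P0 : (1 <= p ^ k0)%nat) by (apply Nat.neq_0_lt_0, Nat.pow_nonzero; lia).
    destruct (moebius_dirichlet_partial_sum s m ltac:(lia)) as [k [Hk E]].
    rewrite E. apply H0.
    assert (L : (k0 < S k)%nat) by (apply (Nat.pow_lt_mono_r_iff p); lia). lia.
  - unfold sup_norm.
    apply (proj2 (Lub_Rbar_correct (fun x : R => exists s : C, C_plus s /\ x = Cmod (moebius (nat_cpow p (- s)%C))))).
    intros x [s [Hs ->]]. apply Hb, Hs.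
Qed.

End PrimeFactor.

Theorem mainTheorem7 :
  forall s1 s2 : C, C_plus s1 -> C_plus s2 ->
    gleason_dist s1 s2 =
    sup_primes (fun p : nat =>
      rho_disc (nat_cpow p (- s1)%C) (nat_cpow p (- s2)%C)).
Proof.
  intros s1 s2 Hs1 Hs2. unfold gleason_dist, sup_primes.
  set (E1 := fun x : R => exists f : C -> C,
    H_infty f /\ Rbar_le (sup_norm f) 1 /\ f s2 = RtoC 0 /\ x = Cmod (f s1)).
  set (E2 := fun x : R => exists p : nat, prime (Z.of_nat p) /\
    x = rho_disc (nat_cpow p (- s1)%C) (nat_cpow p (- s2)%C)).
  destruct (Lub_Rbar_correct E1) as [U1 L1]. destruct (Lub_Rbar_correct E2) as [U2 L2].
  apply Rbar_le_antisym.
  - apply L1. intros x [f [Hf [Hn [H0 ->]]]].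
    (* The prime 2 shows that the supremum over primes is not minus infinity and is at least 0; for
       plus infinity the inequality is trivial. *)
    assert (P2 : E2 (rho_disc (nat_cpow 2 (- s1)%C) (nat_cpow 2 (- s2)%C))).
    { exists 2%nat. split; [exact prime_2|reflexivity]. }
    assert (Q := U2 _ P2).
    destruct (Lub_Rbar E2) as [r| |]; [|exact I|exact (False_ind _ Q)].
    simpl in Q |- *.
    assert (Hr : 0 <= r) by (eapply Rle_trans; [apply Cmod_ge_0|exact Q]).
    apply le_epsilon. intros e He.
    (* The supremum r is 0 when s1 = s2, while the upper bound requires a positive number; hence r +
       e. *)
    apply (H_infty_le_of_rho_le f s1 s2 (r + e)); try assumption; [lra|].
    intros p Hp. assert (Qp : rho_disc (nat_cpow p (- s1)%C) (nat_cpow p (- s2)%C) <= r).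
    { exact (U2 _ (ex_intro _ p (conj Hp eq_refl))). }
    lra.
  - apply L2. intros x [p [Hp ->]]. apply U1.
    assert (Hp2 : (2 <= p)%nat) by (apply prime_ge_2 in Hp; lia).
    assert (Ha := Cmod_nat_cpow_lt_1 p s2 Hp2 Hs2).
    assert (Hx := Cmod_nat_cpow_lt_1 p s1 Hp2 Hs1).
    destruct (moebius_H_infty p (nat_cpow p (- s2)%C) Hp2 Ha) as [HH HN].
    exists (fun s => moebius (nat_cpow p (- s2)%C) (nat_cpow p (- s)%C)).
    split; [exact HH|]. split; [exact HN|]. split.
    + unfold moebius. unfold Cminus at 1. rewrite Cplus_opp_r. unfold Cdiv. apply Cmult_0_l.
    + symmetry. apply rho_disc_alt; [assumption|lra].
Qed.
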